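(* Let $\theta=\theta(w)\in\mathbb{R}^n$ be the GTD(1)-solution (equivalently, the MSE-solution) for the target policy $\pi_w$, i.e. the solution of $\lim_{t\to\infty}\mathbb{E}[\rho_t\delta_t e_t]=0$, where $e_t=\phi_t+\gamma\rho_{t-1}e_{t-1}$, $e_{-1}=0$, and $\delta_t=r_{t+1}+\gamma\theta^\top\phi_{t+1}-\theta^\top\phi_t$. Let $J(w)=\sum_{s} d(s)\,\theta(w)^\top\phi(s)=\theta(w)^\top\mathbb{E}[\phi_t]$. Define recursively, for $t\ge 0$, $$f_t=1+\gamma\rho_{t-1}f_{t-1},\qquad \psi_t=f_t\,\nabla\log\pi_w(a_t|s_t)+\gamma\rho_{t-1}\psi_{t-1},$$ with $f_{-1}=0$ and $\psi_{-1}=0$. Then $$\nabla J(w)=\lim_{t\to\infty}\mathbb{E}[\rho_t\,\delta_t\,\psi_t],$$ where $\delta_t$ is evaluated at $\theta=\theta(w)$.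
   Context: Setting: a Markov decision process with finite state set $\mathcal{S}$, finite or infinite action set $\mathcal{A}$, transition probabilities $P(s'|s,a)$, real-valued rewards $r(s,a,s')$, and discount factor $\gamma\in[0,1)$. For infinite $\mathcal{A}$, sums over actions are read as integrals and policies as densities. Data $(s_t,a_t,r_{t+1},s_{t+1})_{t\ge0}$ are generated by a fixed stationary behavior policy $\pi_b$ with $\pi_b(a|s)>0$ for all $(s,a)$: $a_t\sim\pi_b(\cdot|s_t)$, $s_{t+1}\sim P(\cdot|s_t,a_t)$, $r_{t+1}=r(s_t,a_t,s_{t+1})$. The state process is irreducible, aperiodic and in steady state, with stationary distribution $d$ satisfying $d(s)>0$ for all $s$. $\mathbb{E}$ denotes expectation over these data; all expectations involved are assumed finite. The target policy $\pi_w$ is parametrized by $w\in\mathbb{R}^K$; $w\mapsto\pi_w(a|s)$ is twice differentiable for every $(s,a)$, $\sup_{w,s,a}\|\nabla\log\pi_w(a|s)\|<\infty$, and $\nabla\log\pi_w(a|s)$ has bounded derivative. $\nabla$ denotes the gradient (column vector) with respect to $w$. The importance ratio is $\rho_t=\pi_w(a_t|s_t)/\pi_b(a_t|s_t)$. Each state $s$ has a feature vector $\phi(s)\in\mathbb{R}^n$; $\phi_t=\phi(s_t)$. The feature matrix $\Phi\in\mathbb{R}^{|\mathcal{S}|\times n}$, whose row $s$ is $\phi(s)^\top$, has linearly independent columns, and the $n$-th component of $\phi(s)$ equals $1$ for every $s$. The GTD(1)-solution coincides with the minimizer over $\theta$ of $\sum_s d(s)[V^{\pi_w}(s)-\theta^\top\phi(s)]^2$,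 where $V^{\pi_w}$ is the discounted state-value function of $\pi_w$. *)

(* Defs.v *)
From HB Require Import structures.
From mathcomp Require Import all_boot all_order all_algebra.
From mathcomp Require Import all_classical all_reals all_analysis.

Set Implicit Arguments.
Unset Strict Implicit.
Unset Printing Implicit Defensive.
Import Order.TTheory GRing.Theory Num.Theory.
Import numFieldNormedType.Exports.

Local Open Scope classical_set_scope.
Local Open Scope ring_scope.

(* [trans s a s'] is P(s'|s,a) and [reward s a s'] is r(s,a,s').  The action
   space is a measurable space; it is used together with a reference measure
   [mu], so that policies are densities with respect to [mu].  A finite action
   set is the case of the power-set sigma-algebra and the counting measure,
   where integrals against [mu] are sums and densities are probabilities. *)
Record MDP (R : realType) (S : finType) (dA : measure_display)
    (A : measurableType dA) := {
  trans : S -> A -> S -> R;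
  reward : S -> A -> S -> R;
  discount : R;
  trans_ge0 : forall s a s', 0 <= trans s a s';
  trans_sum1 : forall s a, \sum_(s' : S) trans s a s' = 1;
  trans_measurable : forall s s', measurable_fun setT (fun a => trans s a s');
  reward_measurable : forall s s', measurable_fun setT (fun a => reward s a s');
  discount_ge0 : 0 <= discount;
  discount_lt1 : discount < 1 }.

(* [pi s a] is pi(a|s) *)
Definition is_policy (R : realType) (S : finType) (dA : measure_display)
    (A : measurableType dA) (mu : {measure set A -> \bar R})
    (pi : S -> A -> R) : Prop :=
  forall s, [/\ measurable_fun setT (pi s), (forall a, 0 <= pi s a) &
                (\int[mu]_a (pi s a)%:E = 1)%E].

Definition state_kernel (R : realType) (S : finType) (dA : measure_display)
    (A : measurableType dA) (mu : {measure set A -> \bar R})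
    (M : MDP R S A) (pi : S -> A -> R) (s s' : S) : R :=
  \int[mu]_a (pi s a * trans M s a s').

Section MarkovChain.
Context {R : realType} {S : finType}.
Implicit Types p : S -> S -> R.

Fixpoint iter_kernel p (k : nat) (s s' : S) : R :=
  if k is k'.+1 then \sum_(u : S) p s u * iter_kernel p k' u s'
  else (s == s')%:R.

Definition irreducible p : Prop :=
  forall s s', exists k, 0 < iter_kernel p k s s'.

(* the gcd of the return times of every state is 1 *)
Definition aperiodic p : Prop :=
  forall (s : S) (m : nat),
    (forall k, (0 < k)%N -> 0 < iter_kernel p k s s -> (m %| k)%N) -> m = 1%N.

Definition stationary p (d : S -> R) : Prop :=
  [/\ forall s, 0 <= d s, \sum_(s : S) d s = 1 &
      forall s', \sum_(s : S) d s * p s s' = d s'].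

End MarkovChain.

(* The sigma-algebra generated by s_i for i < m and a_j for j < k. *)
Definition history (S : finType) (dA dO : measure_display)
    (A : measurableType dA) (Omega : measurableType dO)
    (St : nat -> Omega -> S) (At : nat -> Omega -> A) (m k : nat) :
    set (set Omega) :=
  <<s [set E | (exists i s, (i < m)%N /\ E = [set om | St i om = s]) \/
               (exists j B, [/\ (j < k)%N, measurable B &
                                E = At j @^-1` B])] >>.

(* The process (s_t, a_t) starts from s_0 ~ d, and, conditionally on the past,
   a_t ~ pib(.|s_t) and s_{t+1} ~ P(.|s_t,a_t). *)
Definition is_mdp_data (R : realType) (S : finType) (dA dO : measure_display)
    (A : measurableType dA) (mu : {measure set A -> \bar R})
    (M : MDP R S A) (pib : S -> A -> R) (d : S -> R)
    (Omega : measurableType dO) (Pr : probability Omega R)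
    (St : nat -> Omega -> S) (At : nat -> Omega -> A) : Prop :=
  [/\ (forall t s, measurable [set om | St t om = s]),
      (forall t, measurable_fun setT (At t)),
      (forall s, Pr [set om | St 0%N om = s] = (d s)%:E),
      (forall t E B, history St At t.+1 t E -> measurable B ->
         Pr (E `&` At t @^-1` B) =
         (\int[Pr]_(om in E) \int[mu]_(a in B) (pib (St t om) a)%:E)%E) &
      (forall t E s', history St At t.+1 t.+1 E ->
         Pr (E `&` [set om | St t.+1 om = s']) =
         (\int[Pr]_(om in E) (trans M (St t om) (At t om) s')%:E)%E)].

Section Vectors.
Context {R : realType}.

Definition grad (k : nat) (f : 'cV[R]_k -> R) (w : 'cV[R]_k) : 'cV[R]_k :=
  \col_(i < k) 'D_(delta_mx i 0) f w.

Definition dotv (n : nat) (u v : 'cV[R]_n) : R := (u^T *m v) 0 0.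

Definition feature_matrix (S : finType) (n : nat) (phi : S -> 'cV[R]_n) :
    'M[R]_(#|S|, n) :=
  \matrix_(i < #|S|) (phi (enum_val i))^T.

Context {dO : measure_display} {Omega : measurableType dO}.
Variable Pr : probability Omega R.

Definition vec_integrable (n : nat) (X : Omega -> 'cV[R]_n) : Prop :=
  forall i : 'I_n, Pr.-integrable setT (fun om => (X om i 0)%:E).

(* meaningful when [vec_integrable X] *)
Definition vec_expectation (n : nat) (X : Omega -> 'cV[R]_n) : 'cV[R]_n :=
  \col_(i < n) fine ('E_Pr[fun om => X om i 0]).

End Vectors.

(* [pi w s a] is pi_w(a|s); [score pi w s a] is the gradient in w of
   log pi_w(a|s) *)
Definition score (R : realType) (S A : Type) (k : nat)
    (pi : 'cV[R]_k -> S -> A -> R) (w : 'cV[R]_k) (s : S) (a : A) : 'cV[R]_k :=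
  grad (fun w' => ln (pi w' s a)) w.

(* The norms are the sup norms of the library; the choice is immaterial in
   finite dimension. *)
Definition regular_parametrization (R : realType) (S A : Type) (k : nat)
    (pi : 'cV[R]_k -> S -> A -> R) : Prop :=
  [/\ (forall s a w, differentiable (fun w' => pi w' s a) w),
      (forall s a w, differentiable (grad (fun w' => pi w' s a)) w),
      (exists C : R, forall w s a, `|score pi w s a| <= C) &
      (forall s a, exists C : R, forall w v,
         `|'d (fun w' => score pi w' s a) w v| <= C * `|v|)].

Section Traces.
Context {R : realType} {S : finType} {dA : measure_display}.
Context {A : measurableType dA} {Omega : Type} {k n : nat}.
Variables (M : MDP R S A) (pib : S -> A -> R) (pi : 'cV[R]_k -> S -> A -> R).
Variable phi : S -> 'cV[R]_n.
Variables (St : nat -> Omega -> S) (At : nat -> Omega -> A).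
Implicit Types (w : 'cV[R]_k) (theta : 'cV[R]_n) (t : nat) (om : Omega).

Definition rho w t om : R :=
  pi w (St t om) (At t om) / pib (St t om) (At t om).

Definition td_error theta t om : R :=
  reward M (St t om) (At t om) (St t.+1 om)
  + discount M * dotv theta (phi (St t.+1 om)) - dotv theta (phi (St t om)).

(* In the three recursions below the initial value at time -1 is 0, so that
   the recursive term is absent at time 0. *)
Fixpoint e_trace w t om : 'cV[R]_n :=
  if t is t'.+1 then
    phi (St t om) + (discount M * rho w t' om) *: e_trace w t' om
  else phi (St 0%N om).

Fixpoint f_trace w t om : R :=
  if t is t'.+1 then 1 + discount M * rho w t' om * f_trace w t' om else 1.

Fixpoint psi_trace w t om : 'cV[R]_k :=
  if t is t'.+1 then
    f_trace w t om *: score pi w (St t om) (At t om)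
    + (discount M * rho w t' om) *: psi_trace w t' om
  else f_trace w 0%N om *: score pi w (St 0%N om) (At 0%N om).

(* rho_t delta_t e_t *)
Definition gtd_term w theta t om : 'cV[R]_n :=
  (rho w t om * td_error theta t om) *: e_trace w t om.

(* rho_t delta_t psi_t *)
Definition grad_term w theta t om : 'cV[R]_k :=
  (rho w t om * td_error theta t om) *: psi_trace w t om.

End Traces.

Definition is_gtd1_solution (R : realType) (S : finType)
    (dA dO : measure_display) (A : measurableType dA)
    (Omega : measurableType dO) (Pr : probability Omega R) (k n : nat)
    (M : MDP R S A) (pib : S -> A -> R) (pi : 'cV[R]_k -> S -> A -> R)
    (phi : S -> 'cV[R]_n) (St : nat -> Omega -> S) (At : nat -> Omega -> A)
    (w : 'cV[R]_k) (theta : 'cV[R]_n) : Prop :=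
  vec_expectation Pr (gtd_term M pib pi phi St At w theta t) @[t --> \oo]
    --> (0 : 'cV[R]_n).

Definition objective (R : realType) (S : finType) (k n : nat) (d : S -> R)
    (phi : S -> 'cV[R]_n) (theta : 'cV[R]_k -> 'cV[R]_n) (w : 'cV[R]_k) : R :=
  \sum_(s : S) d s * dotv (theta w) (phi s).

(* Main.v *)
(* Weight the data by the visited state.  With f_t and psi_t = f_t grad log pi +
   chi_t as in the theorem, the row vectors m_t(s) = E[f_t 1{s_t = s}] and
   x_t(s) = E[chi_t 1{s_t = s}] satisfy
     m_{t+1} = d + gamma m_t P_w,   x_{t+1} = gamma m_t (grad P_w) + gamma x_t P_w,
   because the importance ratio turns pi_b into pi_w.  These recursions are
   contractions, so m_t converges to the discounted occupation measure
   eta_w = d (1 - gamma P_w)^-1, and x_t to the solution of the equation obtained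
   by differentiating eta_w = d + gamma eta_w P_w, that is to grad eta_w.
   Since the last feature is 1, the last component of e_t is f_t, and the last
   GTD equation reads J(w) = eta_w . r_w, where r_w is the expected reward.
   Finally lim E[rho_t delta_t psi_t] = eta_w . grad r_w + (grad eta_w) . r_w:
   the contributions of theta cancel, as in a potential-based reward shaping. *)
From HB Require Import structures.
Require Import Defs.
From mathcomp Require Import all_boot all_order all_algebra.
From mathcomp Require Import all_classical all_reals all_analysis.
From mathcomp Require Import measurable_realfun ring lra.
Import Order.TTheory GRing.Theory Num.Theory.
Import numFieldNormedType.Exports.
Local Open Scope classical_set_scope.
Local Open Scope ring_scope.
Set Implicit Arguments.
Unset Strict Implicit.
Unset Printing Implicit Defensive.

(** * Transfer of integrals *)

(** The data are specified only through probabilities of events, while the argument needs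
    expectations of unbounded products such as rho_t delta_t f_t. The bridge is a transfer
    principle: two weighted measures that agree on events give equal integrals of any measurable
    function. It is used once on the action space, to integrate functions of a_t, and once on the
    history before a_t, to factor out the traces. Integrability of f_t and chi_t on each event s_t =
    s is proved by the same inductions that give their recursions. Integrability of the reward under
    pi_w is extracted from the GTD term at time 0, where the trace is deterministic in its last
    component and d(s) > 0 permits division. The derivative of theta in w is never taken: the
    identity J(w) = eta_w . r_w holds at every w, and its right-hand side is smooth because the
    inverse of 1 - gamma P_w is a rational function of the entries and the score bound makes each
    density log-Lipschitz in w. *)

Section Transfer.
Context {R : realType} {d0 d1 d2 : measure_display}.
Context {T : measurableType d0} {Y1 : measurableType d1}.
Context {Y2 : measurableType d2}.
Import HBNNSimple.

(** The simple functions approximating [f] live on [T], so the right-hand side depends on [m], [k]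
    and [g] only through the integrals of [k] over preimages under [g]. Monotone convergence applies
    after composing with [g], since [k] is nonnegative. *)
Lemma ge0_integral_comp_approx d (Y : measurableType d)
    (m : {measure set Y -> \bar R}) (k : Y -> R) (g : Y -> T) (f : T -> R)
    (mf : measurable_fun setT (EFin \o f)) :
  measurable_fun setT k -> (forall y, 0 <= k y) -> measurable_fun setT g ->
  (forall x, 0 <= f x) ->
  (\int[m]_y (k y * f (g y))%:E =
   lim ((\sum_(r \in range (nnsfun_approx measurableT mf n))
     r%:E * \int[m]_y
       (k y * \1_(nnsfun_approx measurableT mf n @^-1` [set r]) (g y))%:E)
       @[n --> \oo]))%E.
Proof.
move=> mk k0 mg f0; set h := nnsfun_approx measurableT mf.
have mhg n : measurable_fun setT (h n \o g) by exact: measurableT_comp.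
have cvgh y : (EFin \o h ^~ y) @ \oo --> (f y)%:E.
  exact: (@cvg_nnsfun_approx _ _ _ _ measurableT _ mf
    (fun x _ => f0 x)).
have -> : (\int[m]_y (k y * f (g y))%:E =
    lim (\int[m]_y (k y * h n (g y))%:E @[n --> \oo]))%E.
  rewrite -monotone_convergence //.
  - apply: eq_integral => y _; apply/esym/cvg_lim => //.
    exact: (@cvgeZl _ _ _ _ _ (k y)%:E isT (cvgh (g y))).
  - by move=> n; apply/measurable_EFinP; exact: (measurable_funM mk (mhg n)).
  - by move=> n y _; rewrite lee_fin mulr_ge0.
  - move=> y _ a b ab; rewrite lee_fin ler_wpM2l //.
    exact/lefP/nd_nnsfun_approx.
congr (lim (_ @ \oo)); apply/funext => n /=.
transitivity (\int[m]_y (\sum_(r \in range (h n))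
    (k y * (r * \1_(h n @^-1` [set r]) (g y)))%:E))%E.
  apply: eq_integral => y _.
  rewrite fsumEFin // (fimfunE (h n) (g y)) !fsbig_finite //=.
  by rewrite mulr_sumr.
have pre r : measurable (h n @^-1` [set r]) by exact: measurable_funPTI.
have mind r : measurable_fun setT (fun y => k y * \1_(h n @^-1` [set r]) (g y) : R).
  exact: (measurable_funM mk (measurableT_comp (measurable_indic (pre r)) mg)).
rewrite ge0_integral_fsum //; last 2 first.
- move=> r; apply/measurable_EFinP.
  rewrite (_ : (fun _ => _) =
    (fun y => r * (k y * \1_(h n @^-1` [set r]) (g y)))) //.
    exact: measurable_funM.
  by apply/funext => y; rewrite mulrCA.
- move=> r y _; rewrite lee_fin mulr_ge0 //.
  exact: nnfun_muleindic_ge0.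
apply: eq_fsbigr => r; rewrite inE => -[x _ rE].
under eq_integral do rewrite mulrCA EFinM.
rewrite ge0_integralZl //.
- exact/measurable_EFinP.
- by move=> y _; rewrite lee_fin mulr_ge0.
- by rewrite -rE lee_fin.
Qed.

Variables (m1 : {measure set Y1 -> \bar R}) (m2 : {measure set Y2 -> \bar R}).
Variables (k1 : Y1 -> R) (k2 : Y2 -> R) (g1 : Y1 -> T) (g2 : Y2 -> T).
Hypothesis mk1 : measurable_fun setT k1.
Hypothesis mk2 : measurable_fun setT k2.
Hypothesis k1_ge0 : forall y, 0 <= k1 y.
Hypothesis k2_ge0 : forall y, 0 <= k2 y.
Hypothesis mg1 : measurable_fun setT g1.
Hypothesis mg2 : measurable_fun setT g2.
Hypothesis agree : forall B, measurable B ->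
  (\int[m1]_y (k1 y * \1_B (g1 y))%:E = \int[m2]_y (k2 y * \1_B (g2 y))%:E)%E.

(** [agree] says that the image under [g1] of the measure with density [k1] equals the image under
    [g2] of the one with density [k2]; the two approximating sequences then coincide term by
    term. *)
Lemma ge0_integral_transfer (f : T -> R) :
  measurable_fun setT f -> (forall x, 0 <= f x) ->
  (\int[m1]_y (k1 y * f (g1 y))%:E = \int[m2]_y (k2 y * f (g2 y))%:E)%E.
Proof.
move=> mf f0; have mf' : measurable_fun setT (EFin \o f).
  exact/measurable_EFinP.
rewrite !(ge0_integral_comp_approx _ mf') //; congr (lim (_ @ \oo)).
by apply/funext => n /=; apply: eq_fsbigr => r _; rewrite agree.
Qed.

(* No integrability is needed: the positive and negative parts agree. *)
Lemma integral_transfer (f : T -> R) :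
  measurable_fun setT f ->
  (\int[m1]_y (k1 y * f (g1 y))%:E = \int[m2]_y (k2 y * f (g2 y))%:E)%E.
Proof.
move=> mf.
have pos d (Y : measurableType d) (k : Y -> R) (g : Y -> T) :
    (forall y, 0 <= k y) ->
    ((fun y => (k y * f (g y))%:E)^\+ = fun y => (k y * f^\+ (g y))%:E)%E /\
    ((fun y => (k y * f (g y))%:E)^\- = fun y => (k y * f^\- (g y))%:E)%E.
  move=> k0; split; apply/funext => y.
    by rewrite funeposE /funrpos -EFin_max maxr_pMr // mulr0.
  by rewrite funenegE /funrneg -EFinN -EFin_max maxr_pMr // mulr0 mulrN.
rewrite integralE [RHS]integralE.
have [-> ->] := pos _ _ k1 g1 k1_ge0; have [-> ->] := pos _ _ k2 g2 k2_ge0.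
rewrite !ge0_integral_transfer //.
- exact: measurable_funrneg.
- exact: measurable_funrpos.
Qed.

Lemma integrable_transfer (f : T -> R) : measurable_fun setT f ->
  m2.-integrable setT (fun y => (k2 y * f (g2 y))%:E) ->
  m1.-integrable setT (fun y => (k1 y * f (g1 y))%:E).
Proof.
move=> mf /integrableP[_ fin2]; apply/integrableP; split.
  by apply/measurable_EFinP/measurable_funM => //; exact: measurableT_comp.
move: fin2; have abs d (Y : measurableType d) (k : Y -> R) (g : Y -> T) :
    (forall y, 0 <= k y) -> (fun y => `|(k y * f (g y))%:E|%E) =
      fun y => (k y * `|f (g y)|)%:E.
  by move=> k0; apply/funext => y /=; rewrite normrM ger0_norm.
rewrite !abs // -(ge0_integral_transfer (f := fun x => `|f x|)) //.
exact: measurableT_comp.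
Qed.

End Transfer.

(** * Law of the data process *)

Section Data.
Context {R : realType} {S : finType} {dA dO : measure_display}.
Context {A : measurableType dA} {Omega : measurableType dO}.
Variables (mu : {measure set A -> \bar R}) (M : MDP R S A).
Variables (pib : S -> A -> R) (d : S -> R) (Pr : probability Omega R).
Variables (St : nat -> Omega -> S) (At : nat -> Omega -> A).
Hypothesis pib_policy : is_policy mu pib.
Hypothesis data : is_mdp_data mu M pib d Pr St At.

Definition visit t s om : R := (St t om == s)%:R.

(* Omega with the sigma-algebra generated by s_0, a_0, ..., a_{t-1}, s_t *)
Definition past t := g_sigma_algebraType (history St At t.+1 t).

Lemma history_setI m k E F : history St At m k E -> history St At m k F ->
  history St At m k (E `&` F).
Proof.
move=> hE hF.
exact: (@measurableI _ (g_sigma_algebraType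
  [set E | (exists i s, (i < m)%N /\ E = [set om | St i om = s]) \/
               (exists j B, [/\ (j < k)%N, measurable B &
                                E = At j @^-1` B])])).
Qed.

Lemma history_state m k i s : (i < m)%N ->
  history St At m k [set om | St i om = s].
Proof. by move=> im; apply: sub_sigma_algebra; left; exists i, s. Qed.

Lemma history_action m k j B : (j < k)%N -> measurable B ->
  history St At m k (At j @^-1` B).
Proof. by move=> jk mB; apply: sub_sigma_algebra; right; exists j, B. Qed.

Lemma history_le m k m' k' : (m <= m')%N -> (k <= k')%N ->
  history St At m k `<=` history St At m' k'.
Proof.
move=> mm kk; apply: sub_sigma_algebra2 => E [[i [s [im ->]]]|[j [B [jk mB ->]]]].
  by left; exists i, s; split => //; exact: leq_trans mm.
by right; exists j, B; split => //; exact: leq_trans kk.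
Qed.

Lemma measurable_state t s : measurable [set om | St t om = s].
Proof. by case: data. Qed.

Lemma measurable_action t : measurable_fun setT (At t).
Proof. by case: data. Qed.

Lemma measurable_history m k E : history St At m k E -> measurable E.
Proof.
apply: smallest_sub => [|F [[i [s [_ ->]]]|[j [B [_ mB ->]]]]].
- exact: sigma_algebra_measurable.
- exact: measurable_state.
- by rewrite -[X in measurable X]setTI; exact: measurable_action.
Qed.

Lemma measurable_past t (E : set (past t)) :
  measurable E -> history St At t.+1 t E.
Proof.
by apply: smallest_sub => //; exact: smallest_sigma_algebra.
Qed.

Lemma measurable_past_id t : measurable_fun setT (id : Omega -> past t).
Proof.
by move=> _ E mE; rewrite setTI; exact: (measurable_history (measurable_past mE)).
Qed.

Lemma visit_indic t s : visit t s = \1_[set om | St t om = s].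
Proof.
apply/funext => om; rewrite /visit indicE; congr (nat_of_bool _)%:R.
by apply/idP/idP => [/eqP|] /[!inE] // /eqP.
Qed.

Lemma measurable_visit t s : measurable_fun setT (visit t s).
Proof. by rewrite visit_indic; exact/measurable_indic/measurable_state. Qed.

Lemma measurable_trans s s' : measurable_fun setT (fun a => trans M s a s').
Proof. exact: trans_measurable. Qed.

Lemma measurable_behavior s : measurable_fun setT (pib s).
Proof. by case: (pib_policy s). Qed.

Let P_ge0 s a : 0 <= pib s a.
Proof. by case: (pib_policy s). Qed.

(** Fixing s_t = s makes the action density constant over the event, so the iterated integral in the
    definition of the data becomes a product. This settles [G] an indicator, and the transfer to [A]
    gives every measurable [G], integrable or not. *)
Lemma action_law t s E (G : A -> R) :
  history St At t.+1 t E -> measurable_fun setT G ->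
  (\int[Pr]_om (\1_(E `&` [set om | St t om = s]) om * G (At t om))%:E =
   \int[mu]_a (fine (Pr (E `&` [set om | St t om = s])) * pib s a * G a)%:E)%E.
Proof.
move=> hE; set F := E `&` _.
have hF : history St At t.+1 t F by apply: history_setI => //; exact: history_state.
have mF := measurable_history hF.
apply: (integral_transfer (g1 := At t) (g2 := id)) => //.
- exact: measurable_funM (measurable_cst _) (measurable_behavior s).
- by move=> a; rewrite mulr_ge0 // fine_ge0.
- exact: measurable_action.
move=> B mB.
have mAB : measurable (At t @^-1` B).
  by rewrite -[X in measurable X]setTI; exact: measurable_action.
transitivity (Pr (F `&` At t @^-1` B)).
  rewrite -[X in Pr X]setIT -integral_indic //; last exact: measurableI.
  by apply: eq_integral => om _; rewrite (indicI R F (At t @^-1` B)).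
have [_ _ _ + _] := data => /(_ t F B hF mB) ->.
(* On [F] the state at time [t] is [s], so the inner integral no longer depends on [om]. *)
transitivity (\int[Pr]_(om in F) (\int[mu]_(a in B) (pib s a)%:E))%E.
  by apply: eq_integral => om; rewrite inE => -[_ /= ->].
have eB : (\int[mu]_(a in B) (pib s a)%:E = \int[mu]_a (pib s a * \1_B a)%:E)%E.
  rewrite integral_mkcond; apply: eq_integral => a _.
  by rewrite patchE indicE; case: ifP; rewrite ?mulr1 ?mulr0.
rewrite eB; set c := (\int[mu]_a _)%E in eB *.
rewrite (integral_cst Pr mF c); rewrite /c {c eB}.
under [in RHS]eq_integral do rewrite -mulrA EFinM.
rewrite ge0_integralZl //; first last.
- by rewrite lee_fin fine_ge0.
- by move=> a _; rewrite lee_fin mulr_ge0.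
- apply/measurable_EFinP/measurable_funM; first exact: measurable_behavior.
  exact: measurable_indic.
by rewrite fineK ?fin_num_measure // muleC.
Qed.

(** The reward depends on s_t, a_t and s_{t+1} together, so a function of the action has to be
    integrated with both end states fixed. For indicators, the transition law given a_t comes first;
    [action_law] then integrates the transition probability over the action. *)
Lemma transition_law t s s' E (G : A -> R) :
  history St At t.+1 t E -> measurable_fun setT G ->
  (\int[Pr]_om (\1_(E `&` [set om | St t om = s] `&` [set om | St t.+1 om = s']) om
                * G (At t om))%:E =
   \int[mu]_a (fine (Pr (E `&` [set om | St t om = s]))
               * (pib s a * trans M s a s') * G a)%:E)%E.
Proof.
move=> hE; set F := E `&` _.
have hF : history St At t.+1 t F by apply: history_setI => //; exact: history_state.
have mF := measurable_history hF.
have mF' : measurable (F `&` [set om | St t.+1 om = s']).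
  by apply: measurableI => //; exact: measurable_state.
apply: (integral_transfer (g1 := At t) (g2 := id)) => //.
- apply: measurable_funM; first exact: measurable_cst.
  exact: measurable_funM (measurable_behavior s) (measurable_trans s s').
- by move=> a; rewrite !mulr_ge0 ?fine_ge0 ?trans_ge0.
- exact: measurable_action.
move=> B mB.
have hAB : history St At t.+1 t.+1 (At t @^-1` B) by exact: history_action.
have hFB : history St At t.+1 t.+1 (F `&` At t @^-1` B).
  by apply: history_setI => //; apply: history_le hF.
have mFB := measurable_history hFB.
transitivity (Pr (F `&` At t @^-1` B `&` [set om | St t.+1 om = s'])).
  rewrite -[X in Pr X]setIT -integral_indic //; last first.
    by apply: measurableI => //; exact: measurable_state.
  apply: eq_integral => om _.
  by rewrite setIAC (indicI R _ (At t @^-1` B)).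
have [_ _ _ _ ->] := data => //.
transitivity (\int[Pr]_om (\1_F om * (\1_B (At t om) * trans M s (At t om) s'))%:E)%E.
  rewrite integral_mkcond; apply: eq_integral => om _.
  have -> : \1_F om * (\1_B (At t om) * trans M s (At t om) s') =
      \1_(F `&` At t @^-1` B) om * trans M s (At t om) s'.
    by rewrite (indicI R F (At t @^-1` B)) mulrA.
  rewrite patchE indicE.
  case: ifPn => [|_]; last by rewrite mul0r.
  by rewrite inE => -[[_ /= ->] _]; rewrite mul1r.
rewrite (action_law s hE (G := fun a => \1_B a * trans M s a s')); last first.
  exact: measurable_funM (measurable_indic mB) (measurable_trans s s').
by apply: eq_integral => a _; congr (_%:E); rewrite /F; ring.
Qed.

Section Step.
Variables (t : nat) (s s' : S) (X : Omega -> R).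
Hypothesis mX : measurable_fun setT (X : past t -> R).
Hypothesis iX : Pr.-integrable setT (fun om => (visit t s om * X om)%:E).
Implicit Type G : A -> R.

Let weight G om := visit t s om * visit t.+1 s' om * G (At t om).
Let density G a := pib s a * trans M s a s' * G a.

Let measurable_weight G : measurable_fun setT G ->
  measurable_fun setT (weight G).
Proof.
move=> mG; apply: measurable_funM.
  exact: measurable_funM (measurable_visit _ _) (measurable_visit _ _).
exact: measurableT_comp mG (measurable_action t).
Qed.

Let visit_ge0 k u om : 0 <= visit k u om. Proof. exact: ler0n. Qed.

(** Second use of the transfer, now with [G] fixed and the history varying: [weight G] and a
    multiple of the indicator of s_t = s have the same integral over every event known before a_t.
    The target space is [past t] and both maps are the identity. *)
Let past_agree G : measurable_fun setT G -> (forall a, 0 <= G a) ->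
  mu.-integrable setT (EFin \o density G) ->
  forall E : set (past t), measurable E ->
  (\int[Pr]_om (weight G om * \1_E om)%:E =
   \int[Pr]_om (\int[mu]_a density G a * visit t s om * \1_E om)%:E)%E.
Proof.
move=> mG G0 iG E mE; have hE := measurable_past mE.
have mF := measurable_history (history_setI hE (history_state s (ltnSn t))).
transitivity (\int[mu]_a (fine (Pr (E `&` [set om | St t om = s]))
               * (pib s a * trans M s a s') * G a)%:E)%E.
  rewrite -transition_law //; apply: eq_integral => om _; congr (_%:E).
  rewrite /weight !visit_indic (indicI R (E `&` _)) (indicI R E) /=.
  by ring.
transitivity ((fine (Pr (E `&` [set om | St t om = s])))%:E
    * \int[mu]_a (density G a)%:E)%E.
  rewrite -integralZl //; apply: eq_integral => a _.
  by rewrite -EFinM /density; congr (_%:E); ring.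
transitivity ((\int[mu]_a density G a)%:E
    * \int[Pr]_om (\1_(E `&` [set om | St t om = s]) om)%:E)%E.
  rewrite fineK ?fin_num_measure // [in LHS]muleC fineK; last first.
    exact: integrable_fin_num.
  by rewrite integral_indic // setIT.
rewrite -integralZl //.
  apply: eq_integral => om _.
  by rewrite visit_indic (indicI R E) -EFinM /=; congr (_%:E); ring.
exact: integrable_indic.
Qed.

(** The sign condition on [G] makes [weight G] an admissible density for the transfer; [X] may have
    any sign. *)
Let ge0_step G : measurable_fun setT G -> (forall a, 0 <= G a) ->
  mu.-integrable setT (EFin \o density G) ->
  Pr.-integrable setT (fun om => (weight G om * X om)%:E) /\
  \int[Pr]_om (weight G om * X om) =
  (\int[mu]_a density G a) * \int[Pr]_om (visit t s om * X om).
Proof.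
move=> mG G0 iG; set c := \int[mu]_a density G a.
have c0 : 0 <= c.
  by apply: Rintegral_ge0 => a _; rewrite !mulr_ge0 ?trans_ge0.
have mcv : measurable_fun setT (fun om => c * visit t s om).
  exact: measurable_funM (measurable_cst c) (measurable_visit t s).
have mw := measurable_weight mG.
have w0 om : 0 <= weight G om by rewrite !mulr_ge0.
have v0 om : 0 <= c * visit t s om by rewrite mulr_ge0.
have mid := @measurable_past_id t.
have agree := past_agree mG G0 iG.
have iZ : Pr.-integrable setT (fun om => (c * visit t s om * X om)%:E).
  apply: eq_integrable (integrableZl measurableT c iX) => // om _.
  by rewrite -EFinM mulrA.
split; first exact: (integrable_transfer mw mcv w0 v0 mid mid agree mX iZ).
rewrite -RintegralZl //.
rewrite /Rintegral (integral_transfer mw mcv w0 v0 mid mid agree mX).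
by congr fine; apply: eq_integral => om _; rewrite mulrA.
Qed.

(** This is the Markov property: given s_t, the pair (a_t, s_{t+1}) is independent of what was known
    before a_t. Signed [G] is reduced to its positive and negative parts, whose densities are
    dominated by that of [G]. *)
Lemma step_expectation G : measurable_fun setT G ->
  mu.-integrable setT (fun a => (pib s a * trans M s a s' * G a)%:E) ->
  Pr.-integrable setT
    (fun om => (visit t s om * visit t.+1 s' om * G (At t om) * X om)%:E) /\
  \int[Pr]_om (visit t s om * visit t.+1 s' om * G (At t om) * X om) =
  (\int[mu]_a (pib s a * trans M s a s' * G a))
  * \int[Pr]_om (visit t s om * X om).
Proof.
move=> mG iG.
have mp : measurable_fun setT G^\+ by exact: measurable_funrpos.
have mn : measurable_fun setT G^\- by exact: measurable_funrneg.
have part (H : A -> R) : measurable_fun setT H -> (forall a, 0 <= H a <= `|G a|) ->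
    mu.-integrable setT (EFin \o density H).
  move=> mH H_le; apply: le_integrable iG => //.
    apply/measurable_EFinP/measurable_funM => //.
    exact: measurable_funM (measurable_behavior s) (measurable_trans s s').
  move=> a _; have /andP[H0 HG] := H_le a; rewrite lee_fin !normrM.
  by rewrite ler_wpM2l // ger0_norm.
have GE a : `|G a| = G^\+ a + G^\- a.
  by have /(congr1 (@^~ a)) := funrposDneg G.
have Gsplit a : G a = G^\+ a - G^\- a.
  by have /(congr1 (@^~ a)) := funrposBneg G.
have ip : mu.-integrable setT (EFin \o density G^\+).
  by apply: part => // a; rewrite funrpos_ge0 GE lerDl funrneg_ge0.
have in_ : mu.-integrable setT (EFin \o density G^\-).
  by apply: part => // a; rewrite funrneg_ge0 GE lerDr funrpos_ge0.
have [jp ep] := ge0_step mp (@funrpos_ge0 _ _ G) ip.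
have [jn en] := ge0_step mn (@funrneg_ge0 _ _ G) in_.
have wE : (fun om => weight G om * X om) =
    (fun om => weight G^\+ om * X om - weight G^\- om * X om).
  by apply/funext => om; rewrite /weight Gsplit; ring.
have dE : density G = (fun a => density G^\+ a - density G^\- a).
  by apply/funext => a; rewrite /density Gsplit; ring.
split.
  rewrite [X in Pr.-integrable _ X](_ : _ = EFin \o (fun om => weight G om * X om)) //.
  by rewrite wE; exact: (integrableB measurableT jp jn).
transitivity (\int[Pr]_om (weight G om * X om)) => //.
rewrite wE RintegralB // ep en -mulrBl -RintegralB //.
by rewrite -/(density G) dE.
Qed.

End Step.

End Data.
(** * Differentiation under the integral sign *)

Lemma differentiable_linear_approx {R : numFieldType} {V W : normedModType R}
    (f : V -> W) (df : {linear V -> W}) (x : V) : continuous df ->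
  (forall e, 0 < e -> \forall v \near (0 : V),
    `|f (v + x) - f x - df v| <= e * `|v|) ->
  differentiable f x /\ 'd f x = df :> (V -> W).
Proof.
move=> dfc fe.
have fo : f \o shift x = cst (f x) + df +o_ 0 id.
  apply/eqaddoP => e e0; near=> v.
  have -> : (f \o shift x - (cst (f x) + df)) v = f (v + x) - f x - df v.
    by rewrite /= !fctE /= opprD addrA.
  by near: v; exact: fe.
have dE : 'd f x = df :> (V -> W) by exact: diff_unique.
by split=> //; apply/diff_locallyP; rewrite dE.
Unshelve. all: by end_near.
Qed.

Section Gradient.
Context {R : realType} {K : nat}.
Implicit Types (u f : 'cV[R]_K -> R) (v w g : 'cV[R]_K).

Lemma ler_coord_norm v i : `|v i 0| <= `|v|.
Proof.
rewrite [leRHS]mx_normrE.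
exact: (le_bigmax _ (fun ij : 'I_K * 'I_1 => `|v ij.1 ij.2|) (i, 0)).
Qed.

Lemma col_sum_delta v : v = \sum_i v i 0 *: delta_mx i 0.
Proof.
rewrite {1}[v]matrix_sum_delta; apply: eq_bigr => i _.
by rewrite big_ord1.
Qed.

Lemma derive_grad f w v : differentiable f w ->
  'D_v f w = \sum_i v i 0 * grad f w i 0.
Proof.
move=> df; rewrite deriveE // {1}[v]col_sum_delta linear_sum.
by apply: eq_bigr => i _; rewrite linearZ mxE deriveE.
Qed.

Lemma differentiable_dot g w : differentiable (fun v => \sum_i v i 0 * g i 0) w.
Proof.
have -> : (fun v => \sum_i v i 0 * g i 0) =
    \sum_i (fun v => v i 0 * g i 0).
  by apply/funext => v; rewrite fct_sumE.
apply: differentiable_sum => i; apply: differentiableM.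
  exact: differentiable_coord.
exact: differentiable_cst.
Qed.

Lemma differentiable_little_o f w g :
  (forall e, 0 < e -> \forall v \near (0 : 'cV[R]_K),
    `|f (v + w) - f w - \sum_i v i 0 * g i 0| <= e * `|v|) ->
  differentiable f w /\ grad f w = g.
Proof.
move=> fg.
have dot_linear : linear (fun v => \sum_i v i 0 * g i 0 : R).
  move=> a v v' /=; rewrite scaler_sumr -big_split /=; apply: eq_bigr => i _.
  by rewrite !mxE mulrDl -mulrA.
pose dotM := GRing.isLinear.Build _ _ _ _ _ dot_linear.
pose dot : {linear 'cV[R]_K -> R} := HB.pack (fun v => \sum_i v i 0 * g i 0) dotM.
have dotc : continuous dot.
  by move=> v; apply: differentiable_continuous; exact: differentiable_dot.
have [fw df] := differentiable_linear_approx dotc fg.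
split=> //; apply/matrixP => i j; rewrite ord1 mxE deriveE // df /=.
rewrite (bigD1 i) //= big1 => [|k ki]; first by rewrite addr0 mxE !eqxx mul1r.
by rewrite mxE (negbTE ki) mul0r.
Qed.

(** Both signs rest on 1 + y <= exp y: with y = -x, multiplied by exp x, when x is nonnegative; with
    y = x when it is negative. *)
Lemma expR_sub1_le (x c : R) : `|x| <= c -> `|expR x - 1| <= `|x| * expR c.
Proof.
move=> xc; have c0 : 0 <= c by exact: le_trans xc.
have e1 : 1 <= expR c by rewrite -expR0 ler_expR.
have [x0|x0] := leP 0 x.
  rewrite ger0_norm; last by rewrite subr_ge0 -expR0 ler_expR.
  have ex : 1 - x <= expR (- x) by exact: expR_ge1Dx.
  rewrite (ger0_norm x0) in xc *.
  apply: (@le_trans _ _ (x * expR x)); last by rewrite ler_wpM2l // ler_expR.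
  have := ler_wpM2r (expR_ge0 x) ex.
  rewrite (mulrC (expR (- x))) expRxMexpNx_1; lra.
rewrite ler0_norm; last by rewrite subr_le0 -expR0 ler_expR ltW.
have := expR_ge1Dx x; rewrite ltr0_norm // => ex.
apply: (@le_trans _ _ (- x)); first by lra.
by rewrite ler_peMr // oppr_ge0 ltW.
Qed.

Variables (u : 'cV[R]_K -> R) (C : R).
Hypothesis u_gt0 : forall w, 0 < u w.
Hypothesis u_diff : forall w, differentiable u w.
Hypothesis score_le : forall w, `|grad (fun w' => ln (u w')) w| <= C.

Lemma differentiable_ln_comp w : differentiable (fun w' => ln (u w')) w.
Proof.
apply: (@differentiable_comp _ _ _ _ u (@ln R)) => //; apply/derivable1_diffP.
exact: (ex_derive (is_derive := is_derive1_ln (u_gt0 w))).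
Qed.

Lemma grad_ln_comp w i : grad u w i 0 = u w * grad (fun w' => ln (u w')) w i 0.
Proof.
rewrite !mxE !deriveE //; last exact: differentiable_ln_comp.
have dln : derivable (@ln R) (u w) 1.
  exact: (ex_derive (is_derive := is_derive1_ln (u_gt0 w))).
rewrite (@diff_comp _ _ _ _ u (@ln R)) //=; last exact/derivable1_diffP.
rewrite deriv1E // derive1E (@derive_val _ _ _ _ _ _ _ (is_derive1_ln (u_gt0 w))).
by rewrite /GRing.scale /= mulrCA mulfV ?gt_eqF // mulr1.
Qed.

(** Mean value theorem along the segment from [w] to [w + v]. The factor [K] arises because the norm
    is the sup norm, and the directional derivative is a sum of [K] products of coordinates. *)
Lemma ln_lipschitz w v : `|ln (u (w + v)) - ln (u w)| <= K%:R * C * `|v|.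
Proof.
pose L w' := ln (u w'); pose phi (t : R) : R := L (t *: v + w).
have dphi (t : R) : is_derive t 1 phi ('D_v L (t *: v + w)).
  have E : (fun h : R => h^-1 *: ((phi \o shift t) (h *: (1 : R)) - phi t)) =
      (fun h => h^-1 *: ((L \o shift (t *: v + w)) (h *: v) - L (t *: v + w))).
    apply/funext => h; rewrite /phi /= addrA.
    by congr (_ *: (L (_ + w) - _)); rewrite scalerDl /GRing.scale /= mulr1.
  apply: DeriveDef; last by rewrite /derive E.
  rewrite /derivable E.
  exact/diff_derivable/differentiable_ln_comp.
have [|c _] := @MVT R phi _ 0 1 ltr01 (fun t _ => dphi t).
  apply: derivable_within_continuous => t _.
  exact: (ex_derive (is_derive := dphi t)).
rewrite /phi scale1r scale0r add0r subr0 mulr1 (addrC v) /L => ->.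
rewrite derive_grad; last exact: differentiable_ln_comp.
apply: le_trans (ler_norm_sum _ _ _) _.
apply: (@le_trans _ _ (\sum_(i < K) `|v| * C)); last first.
  by rewrite sumr_const card_ord -[leLHS]mulr_natl mulrA mulrAC.
apply: ler_sum => i _; rewrite normrM ler_pM //; first exact: ler_coord_norm.
exact: le_trans (ler_coord_norm _ _) (score_le _).
Qed.

(** The ratio u(w + v) / u(w) is the exponential of a log increment bounded by K C |v|, hence by K
    C. The bound is relative to [u w], which later yields a dominating function that is integrable
    whenever the integrand at [w] is. *)
Lemma increment_le w v : `|v| <= 1 ->
  `|u (w + v) - u w| <= u w * (K%:R * C * expR (K%:R * C)) * `|v|.
Proof.
move=> v1; set c := K%:R * C.
have c0 : 0 <= c by rewrite mulr_ge0 // (le_trans _ (score_le 0)).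
have ln_le := ln_lipschitz w v.
have -> : u (w + v) - u w = u w * (expR (ln (u (w + v)) - ln (u w)) - 1).
  rewrite expRB !lnK ?posrE // mulrBr mulr1 mulrCA mulfV ?mulr1 //.
  by rewrite gt_eqF.
rewrite normrM (gtr0_norm (u_gt0 w)) -mulrA ler_pM2l //.
apply: (le_trans (expR_sub1_le (c := c) _)).
  by apply: (le_trans ln_le); rewrite ler_piMr.
rewrite -(mulrA c) (mulrC (expR c)) mulrA.
by rewrite ler_wpM2r ?expR_ge0.
Qed.

End Gradient.

Section RealIntegral.
Context {R : realType} {d : measure_display} {T : measurableType d}.
Variable m : {measure set T -> \bar R}.
Variables (I : Type) (r : seq I).
Implicit Type f : I -> T -> R.

Lemma integrable_sumr f :
  (forall i, m.-integrable setT (fun x => (f i x)%:E)) ->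
  m.-integrable setT (fun x => (\sum_(i <- r) f i x)%:E).
Proof.
by move=> fi; under eq_fun do rewrite -sumEFin; exact: integrable_sum.
Qed.

Lemma Rintegral_sumr f :
  (forall i, m.-integrable setT (fun x => (f i x)%:E)) ->
  \int[m]_x (\sum_(i <- r) f i x) = \sum_(i <- r) \int[m]_x f i x.
Proof.
move=> fi; rewrite /Rintegral.
under eq_integral do rewrite -sumEFin.
rewrite integral_sum // sum_fine //.
by move=> i _; exact: integrable_fin_num.
Qed.

End RealIntegral.

Lemma differentiable_approx {R : numFieldType} {V W : normedModType R}
    (f : V -> W) (x : V) : differentiable f x ->
  forall e, 0 < e -> \forall v \near (0 : V),
    `|f (v + x) - f x - 'd f x v| <= e * `|v|.
Proof.
move=> /diff_locally /eqaddoP fx e /fx; apply: filterS => v.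
by rewrite /= !fctE /= opprD addrA.
Qed.

Section ParameterIntegral.
Context {R : realType} {d : measure_display} {T : measurableType d}.
Variables (m : {measure set T -> \bar R}) (K : nat).
Variables (p : 'cV[R]_K -> T -> R) (q : T -> R) (C : R).
Hypothesis p_gt0 : forall w x, 0 < p w x.
Hypothesis mp : forall w, measurable_fun setT (p w).
Hypothesis p_diff : forall w x, differentiable (p ^~ x) w.
Let sc w x := grad (fun w' => ln (p w' x)) w.
Hypothesis sc_le : forall w x, `|sc w x| <= C.

(** A partial derivative is the pointwise limit of the difference quotients with steps 1/(n+1), each
    of which is measurable in [x]. *)
Lemma measurable_score w i : measurable_fun setT (fun x => sc w x i 0).
Proof.
pose h (n : nat) x : R := n.+1%:R *
  (ln (p (n.+1%:R^-1 *: delta_mx i 0 + w) x) - ln (p w x)).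
apply: (@measurable_fun_cvg _ _ _ _ h) => [n|x _].
  apply: measurable_funM => //; apply: measurable_funB.
    exact: measurableT_comp (@measurable_ln R) (mp _).
  exact: measurableT_comp (@measurable_ln R) (mp _).
have dl : derivable (fun w' => ln (p w' x)) w (delta_mx i 0).
  by apply: diff_derivable; exact: (differentiable_ln_comp (fun w' => p_gt0 w' x)).
rewrite /sc mxE; have /cvgr_dnbhsP := dl.
move=> /(_ (@harmonic R)).
have -> : (fun n => (harmonic n : R)^-1 *: (((fun w' => ln (p w' x)) \o shift w)
    (harmonic n *: delta_mx i 0) - ln (p w x))) = h ^~ x.
  by apply/funext => n; rewrite /h /harmonic /= invrK.
apply; split=> [n|]; last exact: cvg_harmonic.
by rewrite /harmonic /= invr_eq0 pnatr_eq0.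
Qed.

Hypothesis mq : measurable_fun setT q.
Hypothesis ipq : forall w, m.-integrable setT (fun x => (p w x * q x)%:E).

Lemma integrable_score w i :
  m.-integrable setT (fun x => (p w x * sc w x i 0 * q x)%:E).
Proof.
apply: le_integrable (integrableZl measurableT C (ipq w)) => //.
  apply/measurable_EFinP/measurable_funM => //.
  exact: measurable_funM (mp w) (measurable_score w i).
move=> x _; rewrite -EFinM lee_fin mulrAC mulrC !normrM.
rewrite ler_wpM2r ?mulr_ge0 //.
apply: le_trans (ler_coord_norm _ _) _; apply: le_trans (sc_le w x) _.
exact: ler_norm.
Qed.

(* Bounded scores make p log-Lipschitz, so that its difference quotients at w are
   dominated by a multiple of p w. *)
Lemma differentiable_Rintegral w :
  differentiable (fun w' => \int[m]_x (p w' x * q x)) w /\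
  grad (fun w' => \int[m]_x (p w' x * q x)) w =
    \col_i \int[m]_x (p w x * sc w x i 0 * q x).
Proof.
set h := fun w' => _; set g := \col_i _.
apply: differentiable_little_o => e e0.
(* First-order Taylor remainder of the density, whose gradient is the density times the score. *)
pose rem (v : 'cV[R]_K) x := p (v + w) x - p w x - \sum_i v i 0 * (p w x * sc w x i 0).
have mrem v : measurable_fun setT (rem v).
  apply: measurable_funB; first exact: measurable_funB.
  apply: measurable_sum => i; apply: measurable_funM => //.
  exact: measurable_funM (mp w) (measurable_score w i).
have remE v x : rem v x * q x = p (v + w) x * q x - p w x * q x
    - \sum_i v i 0 * (p w x * sc w x i 0 * q x).
  rewrite /rem !mulrBl; congr (_ - _); rewrite mulr_suml.
  by apply: eq_bigr => i _; rewrite !mulrA.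
have isc (v : 'cV[R]_K) i : m.-integrable setT
    (fun x => (v i 0 * (p w x * sc w x i 0 * q x))%:E).
  exact: integrableZl (integrable_score w i).
have hE v : h (v + w) - h w - \sum_i v i 0 * g i 0 = \int[m]_x (rem v x * q x).
  have -> : (fun x => rem v x * q x) = (fun x => p (v + w) x * q x - p w x * q x
    - \sum_i v i 0 * (p w x * sc w x i 0 * q x)) by apply/funext.
  rewrite RintegralB //; last 2 first.
  - exact: (integrableB measurableT (ipq (v + w)) (ipq w)).
  - by apply: integrable_sumr => i; exact: isc.
  rewrite (RintegralB measurableT (ipq (v + w)) (ipq w)) Rintegral_sumr //.
  congr (_ - _).
  apply: eq_bigr => i _; rewrite RintegralZl //; last exact: integrable_score.
  by rewrite mxE.
(* Dominated convergence is a statement about sequences: if the estimate fails near 0, there are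
   increments [v n] tending to 0 that all violate it. *)
apply: contrapT => not_near.
have /choice[v vP] : forall n : nat, exists v : 'cV[R]_K, `|v| < n.+1%:R^-1 /\
    e * `|v| < `|h (v + w) - h w - \sum_i v i 0 * g i 0|.
  move=> n.
  have n0 : 0 < n.+1%:R^-1 :> R by rewrite invr_gt0.
  apply: contrapT => no_v; apply: not_near.
  apply: filterS (@nbhs0_lt _ 'cV[R]_K _ n0) => v vn.
  by rewrite leNgt; apply/negP => v_bad; apply: no_v; exists v.
have v0 n : 0 < `|v n|.
  rewrite normr_gt0; apply/eqP => vn0; have [_] := vP n.
  rewrite vn0 hE normr0 mulr0 /Rintegral.
  under eq_integral => x _.
    rewrite /rem add0r subrr sub0r big1 => [|i _]; last by rewrite mxE mul0r.
    rewrite oppr0 mul0r; over.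
  by rewrite integral0 normr0 ltxx.
have v_cvg : v n @[n --> \oo] --> (0 : 'cV[R]_K).
  apply/cvgr0Pnorm_lt => eps eps0.
  have /cvgrPdist_lt/(_ _ eps0) := @cvg_harmonic R; apply: filterS => n /=.
  rewrite sub0r normrN ger0_norm ?invr_ge0 // => hn.
  by have [vn _] := vP n; exact: lt_trans hn.
pose F n x := `|v n|^-1 * (rem (v n) x * q x).
(* The first term bounds the increment of the density by [increment_le], the second its linear part,
   both relative to [p w x] and to the size of the increment. *)
pose B := K%:R * C * expR (K%:R * C) + K%:R * C.
have FE n x : `|F n x| = `|v n|^-1 * `|rem (v n) x| * `|q x|.
  by rewrite /F !normrM normfV normr_id mulrA.
have rem_le (v' : 'cV[R]_K) x : `|v'| <= 1 -> `|rem v' x| <= B * p w x * `|v'|.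
  move=> v'1; apply: le_trans (ler_normB _ _) _.
  rewrite /B 2!mulrDl lerD //.
    rewrite (addrC v') (mulrC _ (p w x)).
    exact: (increment_le (p_gt0 ^~ x) (p_diff ^~ x) (sc_le ^~ x)).
  apply: le_trans (ler_norm_sum _ _ _) _.
  apply: (@le_trans _ _ (\sum_(i < K) `|v'| * (p w x * C))); last first.
    rewrite sumr_const card_ord -[leLHS]mulr_natl le_eqVlt; apply/orP; left.
    by apply/eqP; ring.
  apply: ler_sum => i _; rewrite !normrM ler_pM ?ler_coord_norm ?mulr_ge0 //.
  rewrite (gtr0_norm (p_gt0 w x)) ler_pM2l //.
  exact: le_trans (ler_coord_norm _ _) (sc_le w x).
have v1 n : `|v n| <= 1.
  have [/ltW vn _] := vP n; apply: le_trans vn _.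
  by rewrite invf_le1 ?ler1n.
have dom n x : `|F n x| <= B * `|p w x * q x|.
  rewrite FE normrM (gtr0_norm (p_gt0 w x)) mulrA ler_wpM2r //.
  by rewrite ler_pdivrMl // mulrC rem_le.
have F_cvg x : F n x @[n --> \oo] --> 0.
  apply/cvgr0Pnorm_le => eps eps0.
  (* The added 1 keeps the quotient meaningful where [q x] vanishes. *)
  have eps'0 : 0 < eps / (`|q x| + 1) by rewrite divr_gt0 // ltr_wpDl.
  have [N _ NP] := v_cvg _ (differentiable_approx (p_diff w x) eps'0).
  exists N => // n /= /NP /=.
  have -> : p (v n + w) x - p w x - 'd (p^~ x) w (v n) = rem (v n) x.
    rewrite /rem -deriveE // derive_grad //; congr (_ - _).
    apply: eq_bigr => i _; congr (_ * _).
    exact: (grad_ln_comp (p_gt0 ^~ x) (p_diff ^~ x)).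
  move=> rem_eps; rewrite FE.
  apply: (@le_trans _ _ (eps / (`|q x| + 1) * `|q x|)).
    by rewrite ler_wpM2r // ler_pdivrMl // mulrC.
  rewrite mulrAC ler_pdivrMr; last by rewrite ltr_wpDl.
  by rewrite ler_pM2l // lerDl.
have : (\int[m]_x (F n x)%:E @[n --> \oo] --> \int[m]_x (cst 0 x))%E.
  apply: (@dominated_cvg _ _ _ m _ measurableT (fun n x => (F n x)%:E)
     _ (fun x => (B * `|p w x * q x|)%:E)) => //.
  - move=> n; apply/measurable_EFinP; apply: measurable_funM => //.
    exact: measurable_funM.
  - by move=> x _; apply: cvg_EFin; [exact: nearW|exact: F_cvg].
  - exact: (integrableZl measurableT B (integrable_norm (ipq w))).
  - by move=> n x _; rewrite lee_fin dom.
rewrite integral0 => /fine_cvgP[_] /cvgr0Pnorm_lt /(_ e e0) [N _ /(_ N (leqnn N))] /=.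
have iF : m.-integrable setT (fun x => (rem (v N) x * q x)%:E).
  have -> : (fun x => (rem (v N) x * q x)%:E) =
      EFin \o (fun x => p (v N + w) x * q x - p w x * q x
        - \sum_i v N i 0 * (p w x * sc w x i 0 * q x)).
    by apply/funext => x /=; rewrite remE.
  have iS := integrable_sumr (index_enum 'I_K) (isc (v N)).
  exact: (integrableB measurableT
    (integrableB measurableT (ipq (v N + w)) (ipq w)) iS).
rewrite -/(Rintegral m setT (F N)) RintegralZl // normrM normfV normr_id.
rewrite ltr_pdivrMl // => lt_e.
by have [_] := vP N; rewrite hE mulrC ltNge (ltW lt_e).
Qed.

End ParameterIntegral.

(** * Discounted occupation measures *)

Lemma cvg_sumr {R : realType} {T : Type} {F : set_system T} {FF : Filter F}
    (I : Type) (r : seq I) (f : I -> T -> R) (l : I -> R) :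
  (forall i, f i x @[x --> F] --> l i) ->
  \sum_(i <- r) f i x @[x --> F] --> \sum_(i <- r) l i.
Proof.
move=> fl; elim: r => [|i s ih].
  rewrite big_nil; under eq_cvg do rewrite big_nil; exact: cvg_cst.
rewrite big_cons; under eq_cvg do rewrite big_cons; exact: cvgD.
Qed.

Section DifferentiableBig.
Context {R : realType} {V : normedModType R} {I : Type}.
Variables (r : seq I) (f : I -> V -> R) (w : V).

Lemma differentiable_bigsum : (forall i, differentiable (f i) w) ->
  differentiable (fun x => \sum_(i <- r) f i x) w.
Proof.
move=> df; elim: r => [|i s ih].
  by under eq_fun do rewrite big_nil; exact: differentiable_cst.
by under eq_fun do rewrite big_cons; exact: differentiableD.
Qed.

Lemma differentiable_bigprod : (forall i, differentiable (f i) w) ->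
  differentiable (fun x => \prod_(i <- r) f i x) w.
Proof.
move=> df; elim: r => [|i s ih].
  by under eq_fun do rewrite big_nil; exact: differentiable_cst.
by under eq_fun do rewrite big_cons; exact: differentiableM.
Qed.

Lemma is_derive_bigsum (v : V) (df : I -> R) :
  (forall i, is_derive w v (f i) (df i)) ->
  is_derive w v (fun x => \sum_(i <- r) f i x) (\sum_(i <- r) df i).
Proof.
move=> fdf; elim: r => [|i s ih].
  under eq_fun do rewrite big_nil.
  by rewrite big_nil; exact: is_derive_cst.
under eq_fun do rewrite big_cons.
by rewrite big_cons; exact: is_deriveD.
Qed.

End DifferentiableBig.

Section DifferentiableInverse.
Context {R : realType} {V : normedModType R}.

Lemma differentiable_det n (A : V -> 'M[R]_n) w :
  (forall i j, differentiable (fun x => A x i j) w) ->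
  differentiable (fun x => \det (A x)) w.
Proof.
move=> dA; rewrite /determinant; apply: differentiable_bigsum => s.
apply: differentiableM; first exact: differentiable_cst.
exact: differentiable_bigprod.
Qed.

(** Cramer's rule: each entry of the inverse is a cofactor divided by the determinant, and both are
    polynomials in the entries. *)
Lemma differentiable_invmx n (A : V -> 'M[R]_n) w :
  (forall x, A x \in unitmx) ->
  (forall i j, differentiable (fun x => A x i j) w) ->
  forall i j, differentiable (fun x => invmx (A x) i j) w.
Proof.
move=> Au dA i j.
have -> : (fun x => invmx (A x) i j) =
    (fun x => (\det (A x))^-1 * cofactor (A x) j i).
  by apply/funext => x; rewrite /invmx Au !mxE.
apply: differentiableM.
  apply: differentiableV; first exact: differentiable_det.
  by have := Au w; rewrite unitmxE unitfE.
rewrite /cofactor; apply: differentiableM; first exact: differentiable_cst.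
apply: differentiable_det => k l.
have -> : (fun x => row' j (col' i (A x)) k l) =
  (fun x => A x (lift j k) (lift i l)) by apply/funext => x; rewrite !mxE.
exact: dA.
Qed.

End DifferentiableInverse.

Section Occupancy.
Context {R : realType} {S : finType}.
Variable gamma : R.
Hypothesis gamma_ge0 : 0 <= gamma.
Hypothesis gamma_lt1 : gamma < 1.
Implicit Types (P : S -> S -> R) (d x y c : S -> R).

Definition stochastic P : Prop :=
  (forall s s', 0 <= P s s') /\ (forall s, \sum_s' P s s' = 1).

Definition resolvent_mx P : 'M[R]_#|S| :=
  1%:M - gamma *: \matrix_(i, j) P (enum_val i) (enum_val j).

(* The discounted occupation measure d (1 - gamma P)^-1. *)
Definition occupancy d P s : R :=
  ((\row_i d (enum_val i)) *m invmx (resolvent_mx P)) 0 (enum_rank s).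

(** Row vectors are measured in the l1 norm, in which a stochastic matrix acting on the right is
    nonexpansive; the factor gamma then makes every recursion below a contraction. *)
Lemma stochastic_norm_le P x : stochastic P ->
  \sum_s' `|\sum_s x s * P s s'| <= \sum_s `|x s|.
Proof.
move=> [P0 P1]; apply: (@le_trans _ _ (\sum_s' \sum_s `|x s| * P s s')).
  apply: ler_sum => s' _; apply: le_trans (ler_norm_sum _ _ _) _.
  by apply: ler_sum => s _; rewrite normrM (ger0_norm (P0 _ _)).
rewrite exchange_big /=; apply: ler_sum => s _.
by rewrite -mulr_sumr P1 mulr1.
Qed.

Lemma sum_enum_val (f : S -> R) : \sum_(i < #|S|) f (enum_val i) = \sum_s f s.
Proof.
rewrite [RHS](reindex (fun i : 'I_#|S| => enum_val i)) //=.
exact/onW_bij/enum_val_bij.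
Qed.

(** A row vector in the kernel satisfies x = gamma x P, so its l1 norm is at most gamma times itself
    and vanishes. *)
Lemma resolvent_mx_unit P : stochastic P -> resolvent_mx P \in unitmx.
Proof.
move=> Ps; rewrite -row_free_unit; apply: inj_row_free => v v0.
pose x s : R := v 0 (enum_rank s).
have xE s' : x s' = gamma * \sum_s x s * P s s'.
  move/rowP: v0 => /(_ (enum_rank s')).
  rewrite mulmxBr mulmx1 -scalemxAr !mxE => /eqP; rewrite subr_eq0 => /eqP.
  rewrite [in X in _ -> X]/x => ->.
  rewrite -sum_enum_val; congr (_ * _); apply: eq_bigr => i _.
  by rewrite !mxE /x enum_rankK enum_valK.
have x_le : \sum_s `|x s| <= gamma * \sum_s `|x s|.
  apply: (@le_trans _ _ (\sum_s' gamma * `|\sum_s x s * P s s'|)).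
    by apply: ler_sum => s' _; rewrite {1}xE normrM ger0_norm.
  by rewrite -mulr_sumr ler_wpM2l //; exact: stochastic_norm_le.
have : \sum_s `|x s| = 0.
  apply/eqP; rewrite eq_le sumr_ge0 // andbT.
  by rewrite leNgt; apply/negP => x0; move: x_le; rewrite leNgt gtr_pMl // gamma_lt1.
move=> /psumr_eq0P x0; apply/rowP => i; rewrite mxE.
have := x0 (fun s _ => normr_ge0 _) (enum_val i) isT.
by rewrite /x enum_valK => /normr0_eq0.
Qed.

Lemma occupancyE d P s' : stochastic P ->
  occupancy d P s' = d s' + gamma * \sum_s occupancy d P s * P s s'.
Proof.
move=> Ps; have := mulmxKV (resolvent_mx_unit Ps) (\row_i d (enum_val i)).
rewrite /occupancy; move: (_ *m invmx _) => v /rowP /(_ (enum_rank s')).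
rewrite {1}/resolvent_mx mulmxBr mulmx1 -scalemxAr !mxE enum_rankK => /eqP.
rewrite subr_eq => /eqP ->; congr (_ + _ * _).
rewrite -sum_enum_val; apply: eq_bigr => i _.
by rewrite !mxE enum_rankK enum_valK.
Qed.

Lemma contraction_cvg0 (e eps : nat -> R) : (forall t, 0 <= e t) ->
  (forall t, e t.+1 <= gamma * e t + eps t) -> eps t @[t --> \oo] --> 0 ->
  e t @[t --> \oo] --> 0.
Proof.
move=> e0 e_le eps0; apply/cvgr0Pnorm_le => b b0.
(* With this bound on [eps], the level b/2 is a fixed point of the affine map in the recursion; the
   other half of [b] absorbs the geometric decay of the initial error. *)
have b'0 : 0 < (1 - gamma) * (b / 2) by rewrite mulr_gt0 ?subr_gt0 ?divr_gt0.
have /cvgr0Pnorm_le/(_ _ b'0)[N _ epsN] := eps0.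
have eN k : e (N + k)%N <= gamma ^+ k * e N + b / 2.
  elim: k => [|k ih]; first by rewrite addn0 expr0 mul1r lerDl divr_ge0 // ltW.
  rewrite addnS; apply: le_trans (e_le _) _.
  have := epsN (N + k)%N (leq_addr _ _) => /= /ler_normlW eps_le.
  have := ler_wpM2l gamma_ge0 ih; rewrite exprS; lra.
have : gamma ^+ k * e N @[k --> \oo] --> 0.
  rewrite -(mul0r (e N)); apply: cvgM; last exact: cvg_cst.
  by apply: cvg_expr; rewrite ger0_norm.
move=> /cvgr0Pnorm_le /(_ (b / 2)) []; first by rewrite divr_gt0.
move=> k _ ek; exists (N + k)%N => // t /= Nkt.
have -> : t = (N + (t - N))%N by rewrite subnKC // (leq_trans _ Nkt) ?leq_addr.
rewrite ger0_norm // (le_trans (eN _)) //.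
have /ek /= : (k <= t - N)%N by rewrite leq_subRL // (leq_trans _ Nkt) ?leq_addr.
by move=> /ler_normlW; lra.
Qed.

(** The l1 distance between [x t] and [y] contracts by gamma at each step, up to the l1 error of the
    source term. A convergent rather than constant source is allowed because chi_t is driven by the
    means of f_t. *)
Lemma discounted_recursion_cvg P (x c : nat -> S -> R) y c' : stochastic P ->
  (forall t s', x t.+1 s' = c t s' + gamma * \sum_s x t s * P s s') ->
  (forall s, c t s @[t --> \oo] --> c' s) ->
  (forall s', y s' = c' s' + gamma * \sum_s y s * P s s') ->
  forall s, x t s @[t --> \oo] --> y s.
Proof.
move=> Ps xE cc yE s.
pose e t := \sum_s `|x t s - y s|.
have e_cvg : e t @[t --> \oo] --> 0.
  apply: (@contraction_cvg0 _ (fun t => \sum_s `|c t s - c' s|)).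
  - by move=> t; exact: sumr_ge0.
  - move=> t; rewrite addrC.
    apply: (@le_trans _ _ (\sum_s' (`|c t s' - c' s'|
        + gamma * `|\sum_s (x t s - y s) * P s s'|))).
      apply: ler_sum => s' _.
      have -> : x t.+1 s' - y s' =
          (c t s' - c' s') + gamma * \sum_s (x t s - y s) * P s s'.
        rewrite xE [y s']yE; under [in RHS]eq_bigr do rewrite mulrBl.
        by rewrite sumrB; ring.
      by rewrite (le_trans (ler_normD _ _)) // normrM (ger0_norm gamma_ge0).
    rewrite big_split /= -mulr_sumr lerD2l ler_wpM2l //.
    exact: stochastic_norm_le.
  - have e0 : \sum_(u <- index_enum S) `|c' u - c' u| = 0.
      by rewrite big1 // => u _; rewrite subrr normr0.
    rewrite -[X in _ --> X]e0.
    apply: (cvg_sumr (f := fun u t => `|c t u - c' u|)) => u.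
    by apply: cvg_norm; apply: cvgB => //; exact: cvg_cst.
apply/cvgrPdist_le => b b0.
have /cvgr0Pnorm_le/(_ b b0) := e_cvg; apply: filterS => t et.
rewrite distrC (le_trans _ et) // (le_trans _ (ler_norm _)) //.
by rewrite /e (bigD1 s) //= lerDl sumr_ge0.
Qed.

End Occupancy.

Section OccupancyDerivative.
Context {R : realType} {S : finType} {V : normedModType R}.
Variables (gamma : R) (d : S -> R) (P : V -> S -> S -> R).
Hypothesis gamma_ge0 : 0 <= gamma.
Hypothesis gamma_lt1 : gamma < 1.
Hypothesis P_stochastic : forall w, stochastic (P w).
Hypothesis P_diff : forall w s s', differentiable (fun x => P x s s') w.

Lemma differentiable_occupancy w s :
  differentiable (fun x => occupancy gamma d (P x) s) w.
Proof.
have -> : (fun x => occupancy gamma d (P x) s) =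
    (fun x => \sum_i d (enum_val i) * invmx (resolvent_mx gamma (P x)) i (enum_rank s)).
  by apply/funext => x; rewrite /occupancy !mxE; apply: eq_bigr => i _; rewrite !mxE.
apply: differentiable_bigsum => i.
apply: differentiableM; first exact: differentiable_cst.
apply: differentiable_invmx => [x|k l]; first exact: resolvent_mx_unit.
have -> : (fun x => resolvent_mx gamma (P x) k l) =
    (fun x => (1%:M : 'M[R]_#|S|) k l - gamma * P x (enum_val k) (enum_val l)).
  by apply/funext => x; rewrite !mxE.
apply: differentiableB; first exact: differentiable_cst.
by apply: differentiableM; first exact: differentiable_cst.
Qed.

(** Product rule applied to the fixed-point equation [occupancyE] instead of to the inverse matrix;
    the explicit inverse serves only to know beforehand that the derivative exists. *)
Lemma derive_occupancy w v s' :
  'D_v (fun x => occupancy gamma d (P x) s') w =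
  gamma * \sum_s (occupancy gamma d (P w) s * 'D_v (fun x => P x s s') w
                  + 'D_v (fun x => occupancy gamma d (P x) s) w * P w s s').
Proof.
have dP s u : is_derive w v (fun x => P x s u) ('D_v (fun x => P x s u) w).
  by apply/derivableP/diff_derivable.
have dO s : is_derive w v (fun x => occupancy gamma d (P x) s)
    ('D_v (fun x => occupancy gamma d (P x) s) w).
  by apply/derivableP/diff_derivable/differentiable_occupancy.
have -> : (fun x => occupancy gamma d (P x) s') =
    cst (d s') + cst gamma * (fun x => \sum_s occupancy gamma d (P x) s * P x s s').
  by apply/funext => x; rewrite occupancyE.
have dS := is_derive_bigsum (index_enum S) (fun s => is_deriveM (dO s) (dP s s')).
have := is_deriveD (is_derive_cst (d s') w v) (is_deriveM (is_derive_cst gamma w v) dS).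
move=> /@derive_val ->; rewrite add0r scaler0 addr0; congr (_ * _).
by apply: eq_bigr => s _; congr (_ + _); exact: mulrC.
Qed.

End OccupancyDerivative.

(** * Moments of the process at a visited state *)

Section Moments.
Context {R : realType} {S : finType} {dA dO : measure_display}.
Context {A : measurableType dA} {Omega : measurableType dO}.
Variables (mu : {measure set A -> \bar R}) (M : MDP R S A).
Variables (pib : S -> A -> R) (d : S -> R) (Pr : probability Omega R).
Variables (St : nat -> Omega -> S) (At : nat -> Omega -> A).
Hypothesis pib_policy : is_policy mu pib.
Hypothesis pib_gt0 : forall s a, 0 < pib s a.
Hypothesis d_stationary : stationary (state_kernel mu M pib) d.
Hypothesis data : is_mdp_data mu M pib d Pr St At.
Local Notation visit := (visit (R := R) St).

Local Notation past := (past St At).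

Definition visit_mean (X : Omega -> R) t s : R := \int[Pr]_om (visit t s om * X om).

Definition visit_integrable (X : Omega -> R) t : Prop :=
  forall s, Pr.-integrable setT (fun om => (visit t s om * X om)%:E).

Definition step_integrable (G : S -> S -> A -> R) : Prop :=
  forall s s', measurable_fun setT (G s s') /\
    mu.-integrable setT (fun a => (pib s a * trans M s a s' * G s s' a)%:E).

Definition step_mean (G : S -> S -> A -> R) s s' : R :=
  \int[mu]_a (pib s a * trans M s a s' * G s s' a).

Lemma sum_visit t om : \sum_s visit t s om = 1.
Proof.
rewrite (bigD1 (St t om)) //= /visit eqxx big1 ?addr0 // => s.
by rewrite eq_sym => /negbTE ->.
Qed.

Lemma visit_mul t s om (F : S -> R) :
  visit t s om * F (St t om) = visit t s om * F s.
Proof. by rewrite /visit; case: eqP => [->//|_]; rewrite !mul0r. Qed.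

(** Splitting according to s_t reduces to one pair of states at a time, where [step_expectation]
    applies. The matrix [step_mean G] thus propagates the weighted means from time t to t + 1, and
    integrability travels along with them. *)
Lemma visit_mean_step t X G s' : measurable_fun setT (X : past t -> R) ->
  visit_integrable X t -> step_integrable G ->
  visit_integrable (fun om => G (St t om) (St t.+1 om) (At t om) * X om) t.+1 /\
  visit_mean (fun om => G (St t om) (St t.+1 om) (At t om) * X om) t.+1 s' =
  \sum_s visit_mean X t s * step_mean G s s'.
Proof.
move=> mX iX iG.
(* Under the two indicators the states inside [G] can be frozen, leaving a function of the action
   alone. *)
pose Z u s om := visit t s om * visit t.+1 u om * G s u (At t om) * X om.
have ZE u om : visit t.+1 u om * (G (St t om) (St t.+1 om) (At t om) * X om) =
    \sum_s Z u s om.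
  rewrite (visit_mul _ _ _ (fun z => G (St t om) z (At t om) * X om)).
  rewrite -[LHS]mul1r -(sum_visit t om) mulr_suml; apply: eq_bigr => s _.
  rewrite (visit_mul _ _ _ (fun z => visit t.+1 u om * (G z u (At t om) * X om))).
  by rewrite /Z !mulrA.
have step u s := step_expectation pib_policy data mX (iX s)
  (proj1 (iG s u)) (proj2 (iG s u)).
split=> [u|].
  under eq_fun do rewrite ZE.
  by apply: integrable_sumr => s; have [] := step u s.
rewrite /visit_mean; under eq_Rintegral do rewrite ZE.
rewrite Rintegral_sumr => [|s]; last by have [] := step s' s.
by apply: eq_bigr => s _; rewrite mulrC; have [_] := step s' s.
Qed.

Lemma mean_visit_mean X t : visit_integrable X t ->
  Pr.-integrable setT (fun om => (X om)%:E) /\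
  \int[Pr]_om X om = \sum_s visit_mean X t s.
Proof.
move=> iX; have XE om : X om = \sum_s visit t s om * X om.
  by rewrite -mulr_suml sum_visit mul1r.
split; first by under eq_fun do rewrite XE; exact: integrable_sumr.
by under eq_Rintegral do rewrite XE; rewrite Rintegral_sumr.
Qed.

Lemma visit_integrableD X Y t : visit_integrable X t -> visit_integrable Y t ->
  visit_integrable (fun om => X om + Y om) t.
Proof.
move=> iX iY s; under eq_fun do rewrite mulrDr.
exact: (integrableD measurableT (iX s) (iY s)).
Qed.

Lemma visit_meanD X Y t s : visit_integrable X t -> visit_integrable Y t ->
  visit_mean (fun om => X om + Y om) t s = visit_mean X t s + visit_mean Y t s.
Proof.
move=> iX iY; rewrite /visit_mean; under eq_Rintegral do rewrite mulrDr.
by rewrite (RintegralD measurableT (iX s) (iY s)).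
Qed.

Lemma visit_integrableZ X t c : visit_integrable X t ->
  visit_integrable (fun om => c * X om) t.
Proof.
move=> iX s; under eq_fun do rewrite mulrCA.
exact: (integrableZl measurableT c (iX s)).
Qed.

Lemma visit_meanZ X t s c : visit_integrable X t ->
  visit_mean (fun om => c * X om) t s = c * visit_mean X t s.
Proof.
move=> iX; rewrite /visit_mean; under eq_Rintegral do rewrite mulrCA.
by rewrite (RintegralZl _ measurableT (iX s)).
Qed.

Lemma visit_integrable1 t : visit_integrable (fun=> 1) t.
Proof.
move=> s; under eq_fun do rewrite mulr1 visit_indic.
exact/integrable_indic/(measurable_state data).
Qed.

(** A transition probability is one term of a sum equal to 1, so the policy density dominates the
    product. The lemma is later applied to the target policies as well. *)
Lemma behavior_trans_integrable s s' :
  mu.-integrable setT (fun a => (pib s a * trans M s a s')%:E).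
Proof.
have [mp p0 p1] := pib_policy s.
have ip : mu.-integrable setT (fun a => (pib s a)%:E).
  apply/integrableP; split; first exact/measurable_EFinP.
  under eq_integral do rewrite gee0_abs ?lee_fin //.
  by rewrite p1 ltry.
apply: le_integrable ip => //.
  exact/measurable_EFinP/measurable_funM/(measurable_trans M s s').
move=> a _; rewrite lee_fin normrM ger0_norm // ler_piMr //.
rewrite ger0_norm ?trans_ge0 // -(trans_sum1 M s a) (bigD1 s') //= lerDl.
by apply: sumr_ge0 => *; exact: trans_ge0.
Qed.

Lemma step_integrable1 : step_integrable (fun _ _ _ => 1).
Proof.
move=> s s'; split; first exact: measurable_cst.
by under eq_fun do rewrite mulr1; exact: behavior_trans_integrable.
Qed.

(** Stationarity propagates the initial law: the induction step is [visit_mean_step] with both [G]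
    and [X] equal to 1. *)
Lemma visit_mean1 t s : visit_mean (fun=> 1) t s = d s.
Proof.
elim: t s => [|t ih] s.
  have [_ _ p0 _ _] := data; have := p0 s.
  rewrite /visit_mean /Rintegral; under eq_integral do rewrite mulr1 visit_indic.
  rewrite integral_indic ?setIT //; first by move=> /(congr1 fine).
  exact: (measurable_state data).
have m1 : measurable_fun setT (fun _ : past t => 1 : R) by exact: measurable_cst.
have [_] := visit_mean_step s m1 (visit_integrable1 t) step_integrable1.
under [X in X = _]eq_Rintegral do rewrite mulr1.
have [_ _ <-] := d_stationary; rewrite /visit_mean.
under eq_Rintegral do rewrite mulr1.
move=> ->; apply: eq_bigr => u _; rewrite -ih /visit_mean /step_mean /state_kernel.
by congr (_ * _); apply: eq_Rintegral => a _; rewrite mulr1.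
Qed.

(** Goes back from the data to the action space: [transition_law] at time 0 for the absolute value
    of [G] is an identity of possibly infinite integrals, and dividing by [d s] recovers
    integrability against [mu]. *)
Lemma initial_step_integrable s s' (G : A -> R) : 0 < d s ->
  measurable_fun setT G ->
  Pr.-integrable setT
    (fun om => (visit 0 s om * visit 1 s' om * G (At 0%N om))%:E) ->
  mu.-integrable setT (fun a => (pib s a * trans M s a s' * G a)%:E).
Proof.
move=> ds mG /integrableP[_].
have hT : history St At 1 0 setT.
  exact: (@measurableT _ (g_sigma_algebraType
  [set E | (exists i s, (i < 1)%N /\ E = [set om | St i om = s]) \/
               (exists j B, [/\ (j < 0)%N, measurable B &
                                E = At j @^-1` B])])).
have mabs : measurable_fun setT (fun a => `|G a|) by exact: measurableT_comp.
have := transition_law pib_policy data (t := 0) s s' hT mabs.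
rewrite setTI; have [_ _ -> _ _] := data => /= lawE.
have -> : (\int[Pr]_om `|(visit 0 s om * visit 1 s' om * G (At 0%N om))%:E| =
    \int[mu]_a (d s * (pib s a * trans M s a s') * `|G a|)%:E)%E.
  rewrite -lawE; apply: eq_integral => om _.
  rewrite (indicI R) /= !normrM -!visit_indic.
  by congr (_%:E); congr (_ * _ * _); rewrite ger0_norm ?ler0n.
move=> fin; have mF : measurable_fun setT
    (fun a => d s * (pib s a * trans M s a s') * G a).
  apply: measurable_funM => //; apply: measurable_funM => //.
  exact: measurable_funM (measurable_behavior pib_policy s) (measurable_trans M s s').
have iF : mu.-integrable setT
    (fun a => (d s * (pib s a * trans M s a s') * G a)%:E).
  apply/integrableP; split; first exact/measurable_EFinP.
  move: fin; under eq_integral do rewrite -[X in X * `|_|]ger0_norm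
    ?mulr_ge0 ?(ltW ds) ?(ltW (pib_gt0 _ _)) ?trans_ge0 // -normrM.
  by [].
apply: eq_integrable (integrableZl measurableT (d s)^-1 iF) => // a _.
by rewrite -EFinM !mulrA mulVf ?gt_eqF // mul1r.
Qed.

End Moments.

(** * Coordinatewise limits, discounted potentials, and measurability with respect to the past *)

Lemma cvg_col {R : realType} {T : Type} {F : set_system T} {FF : Filter F}
    (k : nat) (u : T -> 'cV[R]_k) (l : 'cV[R]_k) :
  (forall i, u x i 0 @[x --> F] --> l i 0) -> u x @[x --> F] --> l.
Proof.
move=> ul; apply/cvgrPdist_le => e e0.
have near_i i : \forall x \near F, `|l i 0 - u x i 0| <= e.
  by have /cvgrPdist_le/(_ e e0) := ul i.
have : \forall x \near F, forall i, `|l i 0 - u x i 0| <= e.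
  exact: filter_forall.
apply: filterS => x le_e; rewrite [leLHS]mx_normrE.
apply/bigmax_leP; split=> [|[i j] _]; first exact: ltW.
by rewrite ord1 !mxE.
Qed.

Section Flow.
Context {R : realType} {S : finType}.

(** Summation by parts for a flow [Z] on pairs of states: the coefficient of [v s] is the discounted
    inflow minus the outflow at [s]. This is the shaping identity through which theta cancels. *)
Lemma sum_potential (gamma : R) (v : S -> R) (Z : S -> S -> R) :
  \sum_s \sum_s' (gamma * v s' - v s) * Z s s' =
  \sum_s v s * (gamma * (\sum_u Z u s) - \sum_u Z s u).
Proof.
under eq_bigr do (under eq_bigr do rewrite mulrBl; rewrite sumrB).
rewrite sumrB exchange_big /= -sumrB; apply: eq_bigr => s _.
rewrite mulrBr mulrCA !mulr_sumr; congr (_ - _).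
by apply: eq_bigr => u _; ring.
Qed.

End Flow.

Section PastMeasurability.
Context {R : realType} {S : finType} {dA dO : measure_display}.
Context {A : measurableType dA} {Omega : measurableType dO}.
Variables (St : nat -> Omega -> S) (At : nat -> Omega -> A).
Local Notation past := (past St At).

Lemma measurable_past_le t t' (X : Omega -> R) : (t <= t')%N ->
  measurable_fun setT (X : past t -> R) -> measurable_fun setT (X : past t' -> R).
Proof.
move=> tt' mX _ B mB; rewrite setTI; apply: sub_sigma_algebra.
apply: (@history_le _ _ _ _ _ St At t.+1 t) => //.
by apply: measurable_past; rewrite -[X in measurable X]setTI; exact: mX.
Qed.

(** Strict inequality matters: [past t] contains s_t but only the actions before a_t. Finiteness of
    [S] reduces measurability to each section [g s]. *)
Lemma measurable_past_step t j (g : S -> A -> R) : (j < t)%N ->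
  (forall s, measurable_fun setT (g s)) ->
  measurable_fun setT ((fun om => g (St j om) (At j om)) : past t -> R).
Proof.
move=> jt mg.
have -> : (fun om => g (St j om) (At j om)) =
    (fun om => \sum_s visit St j s om * g s (At j om)).
  apply/funext => om; under eq_bigr do rewrite -(visit_mul _ _ _ _ (g ^~ (At j om))).
  by rewrite -mulr_suml sum_visit mul1r.
apply: measurable_sum => s; apply: measurable_funM.
  rewrite visit_indic; apply: measurable_indic; apply: sub_sigma_algebra.
  by apply: history_state; exact: ltnW.
apply: (measurableT_comp (mg s)) => _ B mB; rewrite setTI.
by apply: sub_sigma_algebra; exact: history_action.
Qed.

End PastMeasurability.

(** * Expectations of the traces *)

Section Traces.
Context {R : realType} {S : finType} {dA dO : measure_display}.
Context {A : measurableType dA} {Omega : measurableType dO}.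
Variables (mu : {measure set A -> \bar R}) (M : MDP R S A).
Variables (pib : S -> A -> R) (d : S -> R) (Pr : probability Omega R).
Variables (St : nat -> Omega -> S) (At : nat -> Omega -> A) (K : nat).
Variables (pi : 'cV[R]_K -> S -> A -> R) (C : R) (v : S -> R) (w : 'cV[R]_K).
Hypothesis pib_policy : is_policy mu pib.
Hypothesis pib_gt0 : forall s a, 0 < pib s a.
Hypothesis d_stationary : stationary (state_kernel mu M pib) d.
Hypothesis data : is_mdp_data mu M pib d Pr St At.
Hypothesis pi_policy : forall w, is_policy mu (pi w).
Hypothesis pi_gt0 : forall w s a, 0 < pi w s a.
Hypothesis pi_diff : forall s a w, differentiable (fun w' => pi w' s a) w.
Hypothesis score_le : forall w s a, `|score pi w s a| <= C.
Hypothesis reward_int : forall w s s', mu.-integrable setT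
  (fun a => (pi w s a * (trans M s a s' * reward M s a s'))%:E).
Local Notation gamma := (discount M).
Local Notation past := (past St At).
Local Notation mean := (visit_mean Pr St).
Implicit Types (h : S -> A -> R) (i : 'I_K).

Definition importance_ratio s a : R := pi w s a / pib s a.

Lemma measurable_ratio s : measurable_fun setT (importance_ratio s).
Proof.
(* Positivity of [pib] turns the division into a composition of measurable maps. *)
have -> : importance_ratio s = (fun a => pi w s a * expR (- ln (pib s a))).
  by apply/funext => a; rewrite expRN lnK // posrE.
apply: measurable_funM; first by case: (pi_policy w s).
apply: measurableT_comp; first exact: measurable_expR.
apply: measurable_funN; apply: measurableT_comp; first exact: measurable_ln.
exact: measurable_behavior pib_policy s.
Qed.

Lemma measurable_score_pi s i :
  measurable_fun setT (fun a => score pi w s a i 0).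
Proof.
apply: (@measurable_score _ _ _ K (fun w' => pi w' s)) => //.
by move=> w'; case: (pi_policy w' s).
Qed.

(* [weighted_trans h s s'] and [weighted_reward h s s'] are the parts of
   E_pi[h(s, a)] and E_pi[h(s, a) r] supported by a transition from s to s'. *)
Definition weighted_trans h s s' : R :=
  \int[mu]_a (pi w s a * h s a * trans M s a s').

Definition weighted_reward h s s' : R :=
  \int[mu]_a (pi w s a * h s a * (trans M s a s' * reward M s a s')).

(** Only two weights occur, the constant 1 and a component of the score; a common predicate treats
    the chi and f parts of psi alike. *)
Definition admissible h : Prop :=
  [/\ forall s, measurable_fun setT (h s),
      forall s s', mu.-integrable setT
        (fun a => (pi w s a * h s a * trans M s a s')%:E) &
      forall s s', mu.-integrable setT
        (fun a => (pi w s a * h s a * (trans M s a s' * reward M s a s'))%:E)].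

Lemma admissible1 : admissible (fun _ _ => 1).
Proof.
split=> [s|s s'|s s']; first exact: measurable_cst.
  under eq_fun do rewrite mulr1.
  exact: (behavior_trans_integrable M (pi_policy w)).
by under eq_fun do rewrite mulr1; exact: reward_int.
Qed.

Lemma admissible_score i : admissible (fun s a => score pi w s a i 0).
Proof.
split=> [s|s s'|s s']; first exact: measurable_score_pi.
- apply: (@integrable_score _ _ _ _ K (fun w' => pi w' s)
    (fun a => trans M s a s') C) => //.
  + by move=> w'; case: (pi_policy w' s).
  + by move=> w' a; exact: score_le.
  + exact: (measurable_trans M s s').
  + by move=> w'; exact: (behavior_trans_integrable M (pi_policy w')).
- apply: (@integrable_score _ _ _ _ K (fun w' => pi w' s)
    (fun a => trans M s a s' * reward M s a s') C) => //.
  + by move=> w'; case: (pi_policy w' s).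
  + by move=> w' a; exact: score_le.
  + exact: measurable_funM (measurable_trans M s s') (reward_measurable M s s').
Qed.

(** The value estimate is an arbitrary potential [v] here; theta enters only in the final theorem,
    through v(s) = theta . phi(s). *)
Definition td s s' a : R := reward M s a s' + gamma * v s' - v s.

Lemma behavior_ratio s s' a (x : R) :
  pib s a * trans M s a s' * (importance_ratio s a * x) = pi w s a * x * trans M s a s'.
Proof.
rewrite /importance_ratio; have := gt_eqF (pib_gt0 s a) => /negbT p0.
by field.
Qed.

Lemma step_integrable_ratio h : admissible h ->
  step_integrable mu M pib (fun s _ a => importance_ratio s a * h s a).
Proof.
move=> [mh ih _] s s'; split; first exact: measurable_funM (measurable_ratio s) (mh s).
by under eq_fun do rewrite behavior_ratio; exact: ih.
Qed.

Lemma step_mean_ratio h s s' :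
  step_mean mu M pib (fun s _ a => importance_ratio s a * h s a) s s' =
  weighted_trans h s s'.
Proof. by apply: eq_Rintegral => a _; rewrite behavior_ratio. Qed.

Let behavior_td h s s' a :
  pib s a * trans M s a s' * (importance_ratio s a * (h s a * td s s' a)) =
  pi w s a * h s a * (trans M s a s' * reward M s a s')
  + (gamma * v s' - v s) * (pi w s a * h s a * trans M s a s').
Proof. by rewrite behavior_ratio /td; ring. Qed.

Lemma step_integrable_td h : admissible h ->
  step_integrable mu M pib (fun s s' a => importance_ratio s a * (h s a * td s s' a)).
Proof.
move=> [mh ih ir] s s'; split.
  apply: measurable_funM (measurable_ratio s) (measurable_funM (mh s) _).
  apply: measurable_funB => //; apply: measurable_funD => //.
  exact: reward_measurable.
under eq_fun do rewrite behavior_td.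
exact: (integrableD measurableT (ir s s') (integrableZl measurableT _ (ih s s'))).
Qed.

Lemma step_mean_td h s s' : admissible h ->
  step_mean mu M pib (fun s s' a => importance_ratio s a * (h s a * td s s' a)) s s' =
  weighted_reward h s s' + (gamma * v s' - v s) * weighted_trans h s s'.
Proof.
move=> [mh ih ir]; rewrite /step_mean; under eq_Rintegral do rewrite behavior_td.
rewrite (RintegralD measurableT (ir s s')); last first.
  exact: (integrableZl measurableT _ (ih s s')).
by rewrite (RintegralZl _ measurableT (ih s s')).
Qed.

Local Notation f_trace := (f_trace M pib pi St At w).
Local Notation psi_trace := (psi_trace M pib pi St At w).
Local Notation rho := (rho pib pi St At w).
Local Notation score_at t := (fun om => score pi w (St t om) (At t om)).
Local Notation one := (fun (_ : S) (_ : A) => 1 : R).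
Local Notation score_comp i := (fun s a => score pi w s a i 0).

(* chi_t = gamma rho_{t-1} psi_{t-1} is the part of psi_t known before a_t *)
Definition chi_trace i t om : R :=
  if t is t'.+1 then gamma * rho t' om * psi_trace t' om i 0 else 0.

Lemma psi_traceE i t om :
  psi_trace t om i 0 = f_trace t om * score pi w (St t om) (At t om) i 0
                       + chi_trace i t om.
Proof. by case: t => [|t] /=; rewrite !mxE ?addr0. Qed.

(** Each summand is an importance ratio times an admissible weight times a quantity known before
    a_t, the shape required by [visit_mean_step]; hence the explicit factor 1. *)
Lemma chi_traceS i t om : chi_trace i t.+1 om =
  gamma * (importance_ratio (St t om) (At t om) * score pi w (St t om) (At t om) i 0
           * f_trace t om
           + importance_ratio (St t om) (At t om) * 1 * chi_trace i t om).
Proof. by rewrite /= psi_traceE /Defs.rho -/(importance_ratio _ _); ring. Qed.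

Lemma f_traceS t om : f_trace t.+1 om =
  1 + gamma * (importance_ratio (St t om) (At t om) * 1 * f_trace t om).
Proof. by rewrite /= /Defs.rho -/(importance_ratio _ _); ring. Qed.

Lemma measurable_f_trace t : measurable_fun setT (f_trace t : past t -> R).
Proof.
elim: t => [|t ih]; first exact: measurable_cst.
have -> : f_trace t.+1 = (fun om =>
    1 + gamma * (importance_ratio (St t om) (At t om) * 1 * f_trace t om)).
  by apply/funext => om; rewrite f_traceS.
apply: measurable_funD => //; apply: measurable_funM => //.
apply: measurable_funM; last exact: (measurable_past_le (leqnSn t) ih).
apply: measurable_funM => //.
exact: measurable_past_step (ltnSn t) measurable_ratio.
Qed.

Lemma measurable_chi_trace i t :
  measurable_fun setT (chi_trace i t : past t -> R).
Proof.
elim: t => [|t ih]; first exact: measurable_cst.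
have -> : chi_trace i t.+1 = (fun om =>
    gamma * (importance_ratio (St t om) (At t om) * score pi w (St t om) (At t om) i 0
           * f_trace t om
           + importance_ratio (St t om) (At t om) * 1 * chi_trace i t om)).
  by apply/funext => om; rewrite chi_traceS.
have mr := measurable_past_step (St := St) (At := At) (ltnSn t) measurable_ratio.
apply: measurable_funM => //; apply: measurable_funD; apply: measurable_funM.
- apply: measurable_funM mr _.
  exact: measurable_past_step (ltnSn t) (measurable_score_pi ^~ i).
- exact: (measurable_past_le (leqnSn t) (@measurable_f_trace t)).
- exact: measurable_funM mr _.
- exact: (measurable_past_le (leqnSn t) ih).
Qed.

Let i_one := step_integrable_ratio admissible1.
Let i_score i := step_integrable_ratio (admissible_score i).

(** Integrability and the recursion for the means are proved together, since the former at time t +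
    1 comes from the same step from time t. *)
Lemma f_trace_step t : visit_integrable Pr St (f_trace t) t ->
  visit_integrable Pr St (f_trace t.+1) t.+1 /\
  forall s', mean (f_trace t.+1) t.+1 s' =
    d s' + gamma * \sum_s mean (f_trace t) t s * weighted_trans one s s'.
Proof.
move=> fi; have step s' :=
  visit_mean_step pib_policy data s' (@measurable_f_trace t) fi i_one.
have fE : f_trace t.+1 = (fun om =>
    1 + gamma * (importance_ratio (St t om) (At t om) * 1 * f_trace t om)).
  by apply/funext => om; rewrite f_traceS.
have i1 := visit_integrable1 data t.+1.
have ir : visit_integrable Pr St
    (fun om => importance_ratio (St t om) (At t om) * 1 * f_trace t om) t.+1.
  by move=> s; have [+ _] := step s; apply.
split=> [|s']; rewrite fE.
  exact: visit_integrableD i1 (visit_integrableZ _ ir).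
rewrite (visit_meanD _ i1 (visit_integrableZ _ ir)) (visit_meanZ _ _ ir).
rewrite (visit_mean1 pib_policy d_stationary data).
have [_ ->] := step s'; congr (_ + _ * _).
by apply: eq_bigr => s _; rewrite step_mean_ratio.
Qed.

Lemma visit_integrable_f_trace t : visit_integrable Pr St (f_trace t) t.
Proof.
elim: t => [|t ih]; first exact: (visit_integrable1 data 0).
by have [] := f_trace_step ih.
Qed.

Lemma chi_trace_step i t : visit_integrable Pr St (chi_trace i t) t ->
  visit_integrable Pr St (chi_trace i t.+1) t.+1 /\
  forall s', mean (chi_trace i t.+1) t.+1 s' =
    gamma * (\sum_s mean (f_trace t) t s * weighted_trans (score_comp i) s s')
    + gamma * (\sum_s mean (chi_trace i t) t s * weighted_trans one s s').
Proof.
move=> ci.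
have stepf s' := visit_mean_step pib_policy data s' (@measurable_f_trace t)
  (@visit_integrable_f_trace t) (i_score i).
have stepc s' := visit_mean_step pib_policy data s' (@measurable_chi_trace i t)
  ci i_one.
have chiE : chi_trace i t.+1 = (fun om => gamma *
    (importance_ratio (St t om) (At t om) * score pi w (St t om) (At t om) i 0 * f_trace t om
     + importance_ratio (St t om) (At t om) * 1 * chi_trace i t om)).
  by apply/funext => om; rewrite chi_traceS.
have jf : visit_integrable Pr St (fun om => importance_ratio (St t om) (At t om) *
    score pi w (St t om) (At t om) i 0 * f_trace t om) t.+1.
  by move=> s; have [+ _] := stepf s; apply.
have jc : visit_integrable Pr St (fun om => importance_ratio (St t om) (At t om) * 1 *
    chi_trace i t om) t.+1.
  by move=> s; have [+ _] := stepc s; apply.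
split=> [|s']; rewrite chiE.
  exact: visit_integrableZ (visit_integrableD jf jc).
rewrite (visit_meanZ _ _ (visit_integrableD jf jc)) (visit_meanD _ jf jc) mulrDr.
have [_ ->] := stepf s'; have [_ ->] := stepc s'.
by congr (_ * _ + _ * _); apply: eq_bigr => s _; rewrite step_mean_ratio.
Qed.

Lemma visit_integrable_chi_trace i t : visit_integrable Pr St (chi_trace i t) t.
Proof.
elim: t => [|t ih]; last by have [] := chi_trace_step ih.
by move=> s; under eq_fun do rewrite mulr0; exact: integrable0.
Qed.

(** [weighted_trans one] is the state kernel P_w of the target policy. *)
Lemma stochastic_weighted_trans : stochastic (weighted_trans one).
Proof.
split=> [s s'|s].
  by apply: Rintegral_ge0 => a _; rewrite !mulr_ge0 ?trans_ge0 ?ltW.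
have [_ ih _] := admissible1; rewrite /weighted_trans -Rintegral_sumr; last first.
  exact: ih.
have [_ _ p1] := pi_policy w s; rewrite /Rintegral -[RHS]/(fine 1%E) -p1.
congr fine; apply: eq_integral => a _.
by rewrite -mulr_sumr trans_sum1 !mulr1.
Qed.

Local Notation eta := (occupancy gamma d (weighted_trans one)).

Lemma f_trace_mean_cvg s : mean (f_trace t) t s @[t --> \oo] --> eta s.
Proof.
apply: (discounted_recursion_cvg (discount_ge0 M) (discount_lt1 M)
  (x := fun t s => mean (f_trace t) t s) (c := fun _ => d) stochastic_weighted_trans).
- by move=> t s'; have [_ ->] := f_trace_step (@visit_integrable_f_trace t).
- by move=> u; exact: cvg_cst.
- move=> s'.
  exact: (occupancyE (discount_ge0 M) (discount_lt1 M) d s' stochastic_weighted_trans).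
Qed.

(** The limit is any solution [xi] of the differentiated equation, so that [w] can stay fixed here;
    the derivative of [eta] is substituted at the end. *)
Lemma chi_trace_mean_cvg i (xi : S -> R) :
  (forall s', xi s' = gamma * \sum_s
    (eta s * weighted_trans (score_comp i) s s' + xi s * weighted_trans one s s')) ->
  forall s, mean (chi_trace i t) t s @[t --> \oo] --> xi s.
Proof.
move=> xiE s.
apply: (discounted_recursion_cvg (discount_ge0 M) (discount_lt1 M)
  (x := fun t s => mean (chi_trace i t) t s)
  (c := fun t s' => gamma *
     \sum_s mean (f_trace t) t s * weighted_trans (score_comp i) s s')
  (c' := fun s' => gamma * \sum_s eta s * weighted_trans (score_comp i) s s')
  stochastic_weighted_trans).
- by move=> t s'; have [_ ->] := chi_trace_step (@visit_integrable_chi_trace i t).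
- move=> s'; apply: cvgM; first exact: cvg_cst.
  apply: cvg_sumr => u; apply: cvgM; last exact: cvg_cst.
  exact: f_trace_mean_cvg.
- by move=> s'; rewrite [LHS]xiE big_split mulrDr.
Qed.

Lemma expectation_td h (X : Omega -> R) t : admissible h ->
  measurable_fun setT (X : past t -> R) -> visit_integrable Pr St X t ->
  Pr.-integrable setT (fun om => (importance_ratio (St t om) (At t om) *
    (h (St t om) (At t om) * td (St t om) (St t.+1 om) (At t om)) * X om)%:E) /\
  \int[Pr]_om (importance_ratio (St t om) (At t om) *
    (h (St t om) (At t om) * td (St t om) (St t.+1 om) (At t om)) * X om) =
  \sum_s' \sum_s mean X t s *
    (weighted_reward h s s' + (gamma * v s' - v s) * weighted_trans h s s').
Proof.
move=> ah mX iX.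
have step s' := visit_mean_step pib_policy data s' mX iX (step_integrable_td ah).
have iZ : visit_integrable Pr St (fun om => importance_ratio (St t om) (At t om) *
    (h (St t om) (At t om) * td (St t om) (St t.+1 om) (At t om)) * X om) t.+1.
  by move=> s; have [+ _] := step s; apply.
have [ii ->] := mean_visit_mean iZ; split=> //.
apply: eq_bigr => s' _; have [_ ->] := step s'.
by apply: eq_bigr => s _; rewrite step_mean_td.
Qed.

(** For the flow eta P_w the outflow at s is eta(s) and the discounted inflow is eta(s) - d(s), so
    the potential contributes exactly minus the [d]-average of [v]. With v = theta . phi this
    average is J(w). *)
Lemma td_f_trace_cvg :
  \int[Pr]_om (importance_ratio (St t om) (At t om) *
    (1 * td (St t om) (St t.+1 om) (At t om)) * f_trace t om) @[t --> \oo] -->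
  \sum_s \sum_s' eta s * weighted_reward one s s' - \sum_s d s * v s.
Proof.
under eq_cvg => t.
  have [_ ->] := expectation_td admissible1 (@measurable_f_trace t)
    (@visit_integrable_f_trace t).
  over.
have -> : \sum_s \sum_s' eta s * weighted_reward one s s' - \sum_s d s * v s =
  \sum_s' \sum_s eta s * (weighted_reward one s s'
     + (gamma * v s' - v s) * weighted_trans one s s').
  rewrite [RHS]exchange_big /=.
  under [RHS]eq_bigr do
    (under eq_bigr do rewrite mulrDr mulrCA; rewrite big_split /=).
  rewrite big_split /=; congr (_ + _).
  rewrite sum_potential -sumrN; apply: eq_bigr => s _.
  have [_ P1] := stochastic_weighted_trans.
  rewrite -mulr_sumr P1 mulr1.
  (* Only the outflow term is unfolded, so that the discounted inflow cancels and -d(s) remains. *)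
  rewrite [X in _ = _ * (_ - X)](occupancyE (discount_ge0 M) (discount_lt1 M) d s
    stochastic_weighted_trans).
  by ring.
apply: cvg_sumr => s'; apply: cvg_sumr => s.
by apply: cvgM; [exact: f_trace_mean_cvg|exact: cvg_cst].
Qed.

(** The potential now contributes nothing: by the equation for [xi] the discounted inflow at s is
    xi(s), and by the vanishing row sums of the score-weighted kernel the outflow is xi(s) too. *)
Lemma td_psi_trace_cvg i (xi : S -> R) :
  (forall s', xi s' = gamma * \sum_s
    (eta s * weighted_trans (score_comp i) s s' + xi s * weighted_trans one s s')) ->
  (forall s, \sum_s' weighted_trans (score_comp i) s s' = 0) ->
  \int[Pr]_om (importance_ratio (St t om) (At t om) *
    td (St t om) (St t.+1 om) (At t om) * psi_trace t om i 0) @[t --> \oo] -->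
  \sum_s \sum_s' (eta s * weighted_reward (score_comp i) s s'
                  + xi s * weighted_reward one s s').
Proof.
move=> xiE score0.
under eq_cvg => t.
  have [if_ ef] := expectation_td (admissible_score i) (@measurable_f_trace t)
    (@visit_integrable_f_trace t).
  have [ic ec] := expectation_td admissible1 (@measurable_chi_trace i t)
    (@visit_integrable_chi_trace i t).
  under eq_Rintegral => om _.
    rewrite psi_traceE.
    rewrite (_ : _ * _ = importance_ratio (St t om) (At t om) *
      (score pi w (St t om) (At t om) i 0 *
        td (St t om) (St t.+1 om) (At t om)) * f_trace t om
      + importance_ratio (St t om) (At t om) *
      (1 * td (St t om) (St t.+1 om) (At t om)) * chi_trace i t om); last by ring.
    over.
  rewrite (RintegralD measurableT if_ ic) ef ec.
  over.
have -> : \sum_s \sum_s' (eta s * weighted_reward (score_comp i) s s'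
                  + xi s * weighted_reward one s s') =
  \sum_s' \sum_s eta s * (weighted_reward (score_comp i) s s'
     + (gamma * v s' - v s) * weighted_trans (score_comp i) s s') +
  \sum_s' \sum_s xi s * (weighted_reward one s s'
     + (gamma * v s' - v s) * weighted_trans one s s').
  (* By the equation for xi, Z is a circulation up to the discount. *)
  pose Z s s' := eta s * weighted_trans (score_comp i) s s'
                 + xi s * weighted_trans one s s'.
  have potential0 : \sum_s \sum_s' (gamma * v s' - v s) * Z s s' = 0.
    rewrite sum_potential big1 // => s _; rewrite -xiE /Z big_split /=.
    have [_ P1] := stochastic_weighted_trans.
    by rewrite -!mulr_sumr score0 P1 mulr0 add0r mulr1 subrr mulr0.
  rewrite [X in _ = X + _]exchange_big [X in _ = _ + X]exchange_big /=.
  rewrite -[LHS]addr0 -[X in _ + X = _]potential0 -!big_split /=.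
  apply: eq_bigr => s _; rewrite -!big_split; apply: eq_bigr => s' _.
  by rewrite /Z /=; ring.
apply: cvgD; apply: cvg_sumr => s'; apply: cvg_sumr => s; apply: cvgM.
- exact: f_trace_mean_cvg.
- exact: cvg_cst.
- exact: chi_trace_mean_cvg.
- exact: cvg_cst.
Qed.

End Traces.

(** * The gradient of the objective *)

Section WeightedDerivative.
Context {R : realType} {S : finType} {dA : measure_display}.
Context {A : measurableType dA}.
Variables (mu : {measure set A -> \bar R}) (M : MDP R S A) (K : nat).
Variables (pi : 'cV[R]_K -> S -> A -> R) (C : R).
Hypothesis pi_policy : forall w, is_policy mu (pi w).
Hypothesis pi_gt0 : forall w s a, 0 < pi w s a.
Hypothesis pi_diff : forall s a w, differentiable (fun w' => pi w' s a) w.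
Hypothesis score_le : forall w s a, `|score pi w s a| <= C.
Hypothesis reward_int : forall w s s', mu.-integrable setT
  (fun a => (pi w s a * (trans M s a s' * reward M s a s'))%:E).
Local Notation one := (fun (_ : S) (_ : A) => 1 : R).
Implicit Types (w : 'cV[R]_K) (i : 'I_K).

Let differentiable_weighted (q : A -> R) s w : measurable_fun setT q ->
  (forall w', mu.-integrable setT (fun a => (pi w' s a * q a)%:E)) ->
  differentiable (fun w' => \int[mu]_a (pi w' s a * 1 * q a)) w /\
  forall i, 'D_(delta_mx i 0) (fun w' => \int[mu]_a (pi w' s a * 1 * q a)) w =
    \int[mu]_a (pi w s a * score pi w s a i 0 * q a).
Proof.
move=> mq iq.
have -> : (fun w' => \int[mu]_a (pi w' s a * 1 * q a)) =
    (fun w' => \int[mu]_a (pi w' s a * q a)).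
  by apply/funext => w'; apply: eq_Rintegral => a _; rewrite mulr1.
have mp w' : measurable_fun setT (pi w' s) by case: (pi_policy w' s).
have [dw gw] := @differentiable_Rintegral _ _ _ mu K (fun w' => pi w' s) q C
  (fun w' => pi_gt0 w' s) mp (fun w' a => pi_diff s a w')
  (fun w' => score_le w' s) mq iq w.
by split=> // i; have := congr1 (fun g : 'cV_K => g i 0) gw; rewrite !mxE.
Qed.

Lemma differentiable_weighted_trans s s' w :
  differentiable (fun w' => weighted_trans mu M pi w' one s s') w /\
  forall i, 'D_(delta_mx i 0) (fun w' => weighted_trans mu M pi w' one s s') w =
    weighted_trans mu M pi w (fun s a => score pi w s a i 0) s s'.
Proof.
apply: differentiable_weighted => [|w']; first exact: (measurable_trans M s s').
exact: (behavior_trans_integrable M (pi_policy w')).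
Qed.

Lemma differentiable_weighted_reward s s' w :
  differentiable (fun w' => weighted_reward mu M pi w' one s s') w /\
  forall i, 'D_(delta_mx i 0) (fun w' => weighted_reward mu M pi w' one s s') w =
    weighted_reward mu M pi w (fun s a => score pi w s a i 0) s s'.
Proof.
apply: differentiable_weighted => [|w']; last exact: reward_int.
exact: measurable_funM (measurable_trans M s s') (reward_measurable M s s').
Qed.

Let stochastic_one w : stochastic (weighted_trans mu M pi w one).
Proof. exact: stochastic_weighted_trans pi_policy pi_gt0 reward_int. Qed.

(** Derivative of the row sums of P_w, which are constantly 1. *)
Lemma sum_weighted_trans_score w s i :
  \sum_s' weighted_trans mu M pi w (fun s a => score pi w s a i 0) s s' = 0.
Proof.
have der s' : is_derive w (delta_mx i 0)
    (fun w' => weighted_trans mu M pi w' one s s')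
    (weighted_trans mu M pi w (fun s a => score pi w s a i 0) s s').
  have [dw gw] := differentiable_weighted_trans s s' w.
  by rewrite -gw; exact/derivableP/diff_derivable.
have /@derive_val := is_derive_bigsum (index_enum S) der.
have -> : (fun w' => \sum_(s' <- index_enum S) weighted_trans mu M pi w' one s s') =
    cst 1.
  by apply/funext => w'; have [_ ->] := stochastic_one w'.
by rewrite derive_cst.
Qed.

Variable d : S -> R.
Local Notation gamma := (discount M).
Local Notation eta w := (occupancy gamma d (weighted_trans mu M pi w one)).

Let differentiable_eta w s : differentiable (fun w' => eta w' s) w.
Proof.
apply: (differentiable_occupancy d (discount_ge0 M) (discount_lt1 M)
  (P := fun w' => weighted_trans mu M pi w' one)) => // w' u u'.
by have [] := differentiable_weighted_trans u u' w'.
Qed.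

Lemma derive_eta w i s' :
  'D_(delta_mx i 0) (fun w' => eta w' s') w = gamma * \sum_s
    (eta w s * weighted_trans mu M pi w (fun s a => score pi w s a i 0) s s'
     + 'D_(delta_mx i 0) (fun w' => eta w' s) w * weighted_trans mu M pi w one s s').
Proof.
rewrite (derive_occupancy d (discount_ge0 M) (discount_lt1 M)
  (P := fun w' => weighted_trans mu M pi w' one)) //; last first.
  by move=> w' u u'; have [] := differentiable_weighted_trans u u' w'.
congr (_ * _); apply: eq_bigr => s _.
by have [_ ->] := differentiable_weighted_trans s s' w.
Qed.

Lemma differentiable_return w :
  differentiable (fun w' =>
    \sum_s \sum_s' eta w' s * weighted_reward mu M pi w' one s s') w.
Proof.
apply: differentiable_bigsum => s; apply: differentiable_bigsum => s'.
apply: differentiableM; first exact: differentiable_eta.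
by have [] := differentiable_weighted_reward s s' w.
Qed.

Lemma grad_return w i :
  grad (fun w' =>
    \sum_s \sum_s' eta w' s * weighted_reward mu M pi w' one s s') w i 0 =
  \sum_s \sum_s'
    (eta w s * weighted_reward mu M pi w (fun s a => score pi w s a i 0) s s'
     + 'D_(delta_mx i 0) (fun w' => eta w' s) w * weighted_reward mu M pi w one s s').
Proof.
rewrite mxE; apply: (@derive_val _ _ _ _ _ _ _ _).
apply: is_derive_bigsum => s; apply: is_derive_bigsum => s'.
have [dr gr] := differentiable_weighted_reward s s' w.
have der : is_derive w (delta_mx i 0)
    (fun w' => weighted_reward mu M pi w' one s s')
    (weighted_reward mu M pi w (fun s a => score pi w s a i 0) s s').
  by rewrite -gr; exact/derivableP/diff_derivable.
have dere : is_derive w (delta_mx i 0) (fun w' => eta w' s)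
    ('D_(delta_mx i 0) (fun w' => eta w' s) w).
  exact/derivableP/diff_derivable/differentiable_eta.
apply: is_derive_eq (is_deriveM dere der) _.
by congr (_ + _); exact: mulrC.
Qed.

End WeightedDerivative.

Theorem theorem2 (R : realType) (S : finType)
    (dA : measure_display) (A : measurableType dA)
    (mu : {measure set A -> \bar R}) (M : MDP R S A)
    (pib : S -> A -> R) (d : S -> R)
    (dO : measure_display) (Omega : measurableType dO)
    (Pr : probability Omega R)
    (St : nat -> Omega -> S) (At : nat -> Omega -> A)
    (K n : nat) (pi : 'cV[R]_K -> S -> A -> R)
    (phi : S -> 'cV[R]_n.+1) (theta : 'cV[R]_K -> 'cV[R]_n.+1)
    (pib_policy : is_policy mu pib)
    (pib_gt0 : forall s a, 0 < pib s a)
    (chain_irreducible : irreducible (state_kernel mu M pib))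
    (chain_aperiodic : aperiodic (state_kernel mu M pib))
    (d_stationary : stationary (state_kernel mu M pib) d)
    (d_gt0 : forall s, 0 < d s)
    (data : is_mdp_data mu M pib d Pr St At)
    (pi_policy : forall w, is_policy mu (pi w))
    (pi_gt0 : forall w s a, 0 < pi w s a)
    (pi_regular : regular_parametrization pi)
    (phi_free : row_free (feature_matrix phi)^T)
    (phi_last : forall s, phi s ord_max 0 = 1)
    (gtd_finite : forall w t,
       vec_integrable Pr (gtd_term M pib pi phi St At w (theta w) t))
    (grad_finite : forall w t,
       vec_integrable Pr (grad_term M pib pi phi St At w (theta w) t))
    (theta_gtd : forall w,
       is_gtd1_solution Pr M pib pi phi St At w (theta w))
    (w : 'cV[R]_K) :
  differentiable (objective d phi theta) w /\
  vec_expectation Pr (grad_term M pib pi phi St At w (theta w) t)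
    @[t --> \oo] --> grad (objective d phi theta) w.
Proof.
have [pi_diff _ [C score_le] _] := pi_regular.
pose v w' s := dotv (theta w') (phi s).
pose one (s : S) (a : A) : R := 1.
have e_last w' t om :
    e_trace M pib pi phi St At w' t om ord_max 0 = f_trace M pib pi St At w' t om.
  elim: t => [|t ih] /=; first exact: phi_last.
  by rewrite !mxE phi_last ih.
have gtdE w' t om :
    gtd_term M pib pi phi St At w' (theta w') t om ord_max 0 =
    importance_ratio pib pi w' (St t om) (At t om) *
    (1 * td M (v w') (St t om) (St t.+1 om) (At t om)) *
    f_trace M pib pi St At w' t om.
  by rewrite mxE e_last mul1r.
(* At time 0 the last GTD component is rho_0 delta_0. Restricting it to s_0 = s and s_1 = s' and
   passing to the action space makes the TD error integrable under pi_w; subtracting its bounded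
   potential part leaves the reward. *)
have reward_int w' s s' : mu.-integrable setT
    (fun a => (pi w' s a * (trans M s a s' * reward M s a s'))%:E).
  have mG : measurable_fun setT
      (fun a => importance_ratio pib pi w' s a * td M (v w') s s' a).
    apply: measurable_funM.
      exact: measurable_ratio pib_policy pib_gt0 pi_policy _.
    apply: measurable_funB => //; apply: measurable_funD => //.
    exact: reward_measurable.
  have mvisit t u := measurable_visit data t u.
  have iG : mu.-integrable setT (fun a => (pib s a * trans M s a s' *
      (importance_ratio pib pi w' s a * td M (v w') s s' a))%:E).
    apply: (initial_step_integrable pib_policy pib_gt0 data (d_gt0 s) mG).
    apply: le_integrable (gtd_finite w' 0%N ord_max) => //.
      apply/measurable_EFinP/measurable_funM.
        exact: measurable_funM (mvisit 0%N s) (mvisit 1%N s').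
      exact: measurableT_comp mG (measurable_action data 0).
    move=> om _; rewrite lee_fin gtdE /visit mulr1 mul1r.
    case: eqP => [<-|_]; last by rewrite !mul0r normr0.
    case: eqP => [<-|_]; last by rewrite mulr0 mul0r normr0.
    by rewrite !mul1r.
  have iP := behavior_trans_integrable M (pi_policy w') s s'.
  have iB := integrableB measurableT iG
    (integrableZl measurableT (discount M * v w' s' - v w' s) iP).
  apply: eq_integrable iB => // a _; rewrite -EFinM -EFinB; congr (_%:E).
  by rewrite (behavior_ratio M pi w' pib_gt0) /td; ring.
pose eta w' := occupancy (discount M) d (weighted_trans mu M pi w' one).
pose J w' := \sum_s \sum_s' eta w' s * weighted_reward mu M pi w' one s s'.
(* The last GTD component tends both to 0 and to [J w'] minus the objective. Holding at every [w'],
   this equates two functions, so they may be differentiated. *)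
have objE : objective d phi theta = J.
  apply/funext => w'; apply/esym/eqP; rewrite -subr_eq0; apply/eqP.
  have lim1 := td_f_trace_cvg (v := v w') (w := w') pib_policy pib_gt0 d_stationary data
    pi_policy pi_gt0 reward_int.
  have lim0 : (vec_expectation Pr (gtd_term M pib pi phi St At w' (theta w') t))
      ord_max 0 @[t --> \oo] --> (0 : R).
    have := cvg_comp _ _ (theta_gtd w') (@coord_continuous _ _ _ ord_max 0 0).
    by rewrite mxE.
  apply: (@cvg_unique _ _ _ _ _ _ lim1); first exact: Rhausdorff.
  apply: cvg_trans lim0; apply: near_eq_cvg; apply: nearW => t.
  rewrite mxE unlock /Rintegral; congr fine; apply: eq_integral => om _.
  by rewrite gtdE.
rewrite objE; split; first exact: differentiable_return.
apply: cvg_col => i.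
have -> : grad J w i 0 = \sum_s \sum_s'
    (eta w s * weighted_reward mu M pi w (fun s a => score pi w s a i 0) s s'
     + 'D_(delta_mx i 0) (fun w' => eta w' s) w * weighted_reward mu M pi w one s s').
  exact: grad_return.
(* Here [xi] is the partial derivative of [eta]; [derive_eta] is precisely the equation required of
   it. *)
have lim := td_psi_trace_cvg (v w) pib_policy pib_gt0 d_stationary data
  pi_policy pi_gt0 pi_diff score_le reward_int
  (derive_eta pi_policy pi_gt0 pi_diff score_le reward_int d w i)
  (fun s => sum_weighted_trans_score pi_policy pi_gt0 pi_diff score_le
    reward_int w s i).
apply: cvg_trans lim; apply: near_eq_cvg; apply: nearW => t.
rewrite mxE unlock /Rintegral; congr fine; apply: eq_integral => om _.
by rewrite mxE.
Qed.
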